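(* Suppose there exist constants $\delta>0$ and $0<\varepsilon<1$ such that $D(\delta|i,a,b)\le 1-\varepsilon$ for all $(i,a,b)\in S\times A\times B$. Then for every $p\in\mathcal P(K)$ the value function of the game $G(p)$ exists, i.e. $\underline V(p,i)=\overline V(p,i)=:V^*(p,i)$ for all $i\in S$, and it satisfies $$V^*(p,i)=\lim_{n\to\infty}V_n^*(p,i),\qquad\forall\, i\in S.$$
   Context: Model. $K,S,A,B$ are finite nonempty sets (game types, states, actions of Player 1, actions of Player 2). For a finite set $E$, $\mathcal P(E)$ is the set of probability distributions on $E$. $Q(\cdot,\cdot|i,a,b)$ is a semi-Markov kernel on $[0,\infty)\times S$ given $S\times A\times B$: for all $i,j,a,b$, $t\mapsto Q(t,j|i,a,b)$ is nondecreasing, right continuous, nonnegative, with $Q(0,j|i,a,b)=0$; $\sum_{j}Q(t,j|i,a,b)\le 1$ for all $t$; and $\sum_j\lim_{t\to\infty}Q(t,j|i,a,b)=1$. Put $D(t|i,a,b):=\sum_{j\in S}Q(t,j|i,a,b)$. The payoff rate is $c:K\times S\times A\times B\to[0,\infty)$, and $\alpha>0$ is a fixed discount factor. $G(p)$ denotes the game with type distribution $p\in\mathcal P(K)$. Policies. $\mathcal H_n=(S\times A\times B)^n\times S$ is the set of histories $h_n=(i_0,a_0,b_0,\dots,a_{n-1},b_{n-1},i_n)$. $\Pi$ is the set of policies of Player 1, i.e. families $\pi=\{\pi_n^{(k)}:k\in K,n\ge0\}$ of stochastic kernels $\pi_n^{(k)}(\cdot|h_n)\in\mathcal P(A)$,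 $h_n\in\mathcal H_n$. $\Sigma$ is the set of policies of Player 2, i.e. families $\sigma=\{\sigma_n:n\ge0\}$ of stochastic kernels $\sigma_n(\cdot|h_n)\in\mathcal P(B)$. Probability. On $\Omega=K\times(S\times A\times B\times[0,\infty))^\infty$ with product $\sigma$-algebra, for $\omega=(k,i_0,a_0,b_0,t_1,i_1,a_1,b_1,t_2,\dots)$ put $\kappa=k$, $X_n=i_n$, $A_n=a_n$, $B_n=b_n$, $T_0=0$, $T_{n}=\sum_{m=1}^{n}t_m$, $H_n=(X_0,A_0,B_0,\dots,A_{n-1},B_{n-1},X_n)$, $T_\infty=\lim_nT_n$. For $p\in\mathcal P(K)$, $i\in S$, $\pi\in\Pi$, $\sigma\in\Sigma$, $\mathbb P_{p,i}^{\pi,\sigma}$ (expectation $\mathbb E_{p,i}^{\pi,\sigma}$) is the unique probability measure with $\mathbb P(X_0=i,\kappa=k)=p_k$; $\mathbb P(A_n=a,B_n=b|\kappa,H_n,T_n)=\pi_n^{(\kappa)}(a|H_n)\sigma_n(b|H_n)$; $\mathbb P(T_{n+1}-T_n\le t,X_{n+1}=j|\kappa,H_n,T_n,A_n,B_n)=Q(t,j|X_n,A_n,B_n)$. Payoff and value. For $t\in[T_n,T_{n+1})$ the continuous-time processes (written with subscript $t$) take the values $X_n,A_n,B_n$. $V(p,i,\pi,\sigma)=\mathbb E_{p,i}^{\pi,\sigma}\big[\int_0^{T_\infty}e^{-\alpha t}c(\kappa,X_t,A_t,B_t)\,dt\big]$; $\underline V(p,i)=\sup_{\pi\in\Pi}\inf_{\sigma\in\Sigma}V(p,i,\pi,\sigma)$,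 $\overline V(p,i)=\inf_{\sigma\in\Sigma}\sup_{\pi\in\Pi}V(p,i,\pi,\sigma)$. Truncated payoff. $V_n(p,i,\pi,\sigma)=\sum_{m=0}^n\mathbb E_{p,i}^{\pi,\sigma}\big[\frac1\alpha(e^{-\alpha T_m}-e^{-\alpha T_{m+1}})c(\kappa,X_m,A_m,B_m)\big]$. $V_n^*(p,i)$ denotes the common value $\sup_{\pi\in\Pi}\inf_{\sigma\in\Sigma}V_n(p,i,\pi,\sigma)=\inf_{\sigma\in\Sigma}\sup_{\pi\in\Pi}V_n(p,i,\pi,\sigma)$ (these two are always equal). *)

(* Defs.v *)
From HB Require Import structures.
From mathcomp Require Import all_boot all_order all_algebra.
From mathcomp Require Import all_classical all_reals all_analysis.

Set Implicit Arguments.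
Unset Strict Implicit.
Unset Printing Implicit Defensive.

Import Order.TTheory GRing.Theory Num.Theory.
Import numFieldNormedType.Exports.

Local Open Scope classical_set_scope.
Local Open Scope ring_scope.

(* Finite nonempty sets: finite types with a distinguished point.  The point
   is only there because measurable spaces are pointed in the library. *)
#[short(type="pfinType")]
HB.structure Definition PointedFinite := {T of Pointed T & Finite T}.

Definition duration (R : realType) : Type := {nonneg R}.
HB.instance Definition _ (R : realType) := Choice.on (duration R).
HB.instance Definition _ (R : realType) :=
  isPointed.Build (duration R) (0%:nng : {nonneg R}).

Record dist (R : realType) (E : finType) := Dist {
  dist_fun :> E -> R ;
  dist_ge0 : forall e, 0 <= dist_fun e ;
  dist_sum1 : \sum_e dist_fun e = 1 }.

Section Model.
Variables (R : realType) (K S A B : pfinType).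

(* [Q t j i a b] is Q(t, j | i, a, b); only its values at t >= 0 matter. *)
Record semi_markov_kernel (Q : R -> S -> S -> A -> B -> R) : Prop := {
  smk_nondecreasing : forall j i a b s t, 0 <= s -> s <= t ->
    Q s j i a b <= Q t j i a b ;
  smk_right_continuous : forall j i a b t, 0 <= t ->
    Q s j i a b @[s --> t^'+] --> Q t j i a b ;
  smk_ge0 : forall j i a b t, 0 <= t -> 0 <= Q t j i a b ;
  smk_at0 : forall j i a b, Q 0 j i a b = 0 ;
  smk_sum_le1 : forall i a b t, 0 <= t -> \sum_j Q t j i a b <= 1 ;
  smk_sum_lim : forall i a b,
    \sum_j lim (Q t j i a b @[t --> +oo]) = 1 }.

Definition sojourn_cdf (Q : R -> S -> S -> A -> B -> R) (t : R) i a b : R :=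
  \sum_j Q t j i a b.

Definition history (n : nat) : Type := (n.-tuple (S * A * B) * S)%type.

Definition policy1 : Type := forall n : nat, K -> history n -> dist R A.
Definition policy2 : Type := forall n : nat, history n -> dist R B.

(* A trajectory (k, i_0, a_0, b_0, t_1, i_1, a_1, b_1, t_2, ...); its n-th
   letter is (i_n, a_n, b_n, t_(n+1)). *)
Definition trajectory : Type := (K * (nat -> S * A * B * duration R))%type.

Definition kappa (w : trajectory) : K := w.1.
Definition state (n : nat) (w : trajectory) : S := (w.2 n).1.1.1.
Definition action1 (n : nat) (w : trajectory) : A := (w.2 n).1.1.2.
Definition action2 (n : nat) (w : trajectory) : B := (w.2 n).1.2.
Definition sojourn (n : nat) (w : trajectory) : R := ((w.2 n).2 : {nonneg R})%:num.

Definition hist (n : nat) (w : trajectory) : history n :=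
  ([tuple (w.2 m).1 | m < n], state n w).

Definition jump_time (n : nat) (w : trajectory) : R :=
  \sum_(m < n) sojourn m w.

Definition explosion_time (w : trajectory) : \bar R :=
  limn (fun n => (jump_time n w)%:E).

(* Generators of the product sigma-algebra: finite coordinates are discrete,
   and [0, +oo[ carries the trace of the Borel sets of R. *)
Definition coordinate_events : set (set trajectory) :=
  [set E | (exists k, E = kappa @^-1` [set k]) \/
    exists n, [\/ exists i, E = state n @^-1` [set i],
                  exists a, E = action1 n @^-1` [set a],
                  exists b, E = action2 n @^-1` [set b] |
                  exists2 U : set R, measurable U & E = sojourn n @^-1` U]].

Definition Omega := g_sigma_algebraType coordinate_events.

(* The sigma-algebra generated by (kappa, H_n, T_n). *)
Definition info (n : nat) : set (set Omega) :=
  <<s [set E | [\/ exists k, E = kappa @^-1` [set k],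
                   exists h, E = hist n @^-1` [set h] |
                   exists2 U : set R, measurable U &
                     E = jump_time n @^-1` U]] >>.

(* The sigma-algebra generated by (kappa, H_n, T_n, A_n, B_n). *)
Definition info_actions (n : nat) : set (set Omega) :=
  <<s [set E | [\/ info n E,
                   exists a, E = action1 n @^-1` [set a] |
                   exists b, E = action2 n @^-1` [set b]]] >>.

(* [f] is a version of the conditional probability P(F | G). *)
Definition is_cond_prob (P : probability Omega R) (F : set Omega)
    (G : set (set Omega)) (f : Omega -> R) : Prop :=
  (forall U : set R, measurable U -> G (f @^-1` U)) /\
  (forall E, G E -> P (F `&` E) = \int[P]_(w in E) (f w)%:E)%E.

(* The identities characterizing the law of the play started at state [i] with
   type distribution [p]; such a law exists by the Ionescu-Tulcea theorem, and
   the identities determine the joint law of (kappa, H_m, A_m, B_m, T_m,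
   T_(m+1)) for each m, hence the payoffs. *)
Record game_law (Q : R -> S -> S -> A -> B -> R) (p : dist R K) (i : S)
    (pi : policy1) (sigma : policy2) (P : probability Omega R) : Prop := {
  law_init : forall k,
    P [set w | state 0 w = i /\ kappa w = k] = (p k)%:E ;
  law_actions : forall n a b,
    is_cond_prob P [set w | action1 n w = a /\ action2 n w = b] (info n)
      (fun w => pi n (kappa w) (hist n w) a * sigma n (hist n w) b) ;
  law_jump : forall n (t : R) j, 0 <= t ->
    is_cond_prob P
      [set w | jump_time n.+1 w - jump_time n w <= t /\ state n.+1 w = j]
      (info_actions n)
      (fun w => Q t j (state n w) (action1 n w) (action2 n w)) }.

(* The n with T_n <= t < T_(n+1), which is unique when 0 <= t < T_oo. *)
Definition stage_at (t : R) (w : trajectory) : nat :=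
  xget 0%N [set n | jump_time n w <= t < jump_time n.+1 w].

Variables (c : K -> S -> A -> B -> R) (alpha : R).

Definition payoff_rate_at (n : nat) (w : trajectory) : R :=
  c (kappa w) (state n w) (action1 n w) (action2 n w).

Definition discounted_payoff (w : trajectory) : \bar R :=
  (\int[lebesgue_measure]_(t in
      [set t : R | (0 <= t)%R /\ t%:E < explosion_time w])
     (expR (- (alpha * t)) * payoff_rate_at (stage_at t w) w)%:E)%E.

Definition stage_payoff (m : nat) (w : trajectory) : R :=
  alpha^-1 * (expR (- (alpha * jump_time m w))
              - expR (- (alpha * jump_time m.+1 w))) * payoff_rate_at m w.

(* The payoffs V and V_n as functions of the law of the play. *)
Definition payoff (P : probability Omega R) : \bar R :=
  (\int[P]_w discounted_payoff w)%E.

Definition truncated_payoff (n : nat) (P : probability Omega R) : \bar R :=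
  (\sum_(m < n.+1) 'E_P[stage_payoff m])%E.

Definition lower_value (V : policy1 -> policy2 -> \bar R) : \bar R :=
  ereal_sup (range (fun pi => ereal_inf (range (fun sigma => V pi sigma)))).

Definition upper_value (V : policy1 -> policy2 -> \bar R) : \bar R :=
  ereal_inf (range (fun sigma => ereal_sup (range (fun pi => V pi sigma)))).

Definition has_value (V : policy1 -> policy2 -> \bar R) (v : R) : Prop :=
  lower_value V = v%:E /\ upper_value V = v%:E.

End Model.

(* Main.v *)
Require Import Defs.
From mathcomp Require Import all_boot all_order all_algebra.
From mathcomp Require Import all_classical all_reals all_analysis.
From mathcomp Require Import measurable_realfun ring lra.

(* Integrating against alpha e^(-alpha t) dt (layer cake) turns the law of the
   play into a closed form: the expectation of e^(-alpha T_n) on the event that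
   the type is k and the first n+1 letters follow a given path is a product of
   a weight of nature, the probability that Player 1 follows the path and the
   probability that Player 2 follows it.  Hence V_n is a finite sum
   sum_y coef_y u_y(pi) w_y(sigma), bilinear in the reach probabilities.  These
   form convex sets (Kuhn's theorem) that are totally bounded, and a
   Blackwell-type argument gives the minimax equality for V_n in the form of
   e-optimal strategies.

   The payoff V exceeds V_n by at most (max c / alpha) E[e^(-alpha T_(n+1))].
   By regularity this expectation is at most beta^(n+1) for some beta < 1, uniformly
   in the policies, so e-optimal strategies for V_n are nearly optimal for V. *)

Set Implicit Arguments.
Unset Strict Implicit.
Unset Printing Implicit Defensive.

Import Order.TTheory GRing.Theory Num.Theory.
Import numFieldNormedType.Exports.

Local Open Scope classical_set_scope.
Local Open Scope ring_scope.

(** * The minimax equality *)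

Section Minimax.
Variable R : realType.

(** The right-hand side is the square of [(1 - l) * Num.max 0 z + l * z'], which dominates the mixed
    value wherever that value is nonnegative. Leaving [z'] untruncated makes the cross term linear
    in the reply. *)
Lemma sq_pos_part_mix (l z z' : R) : 0 <= l <= 1 ->
  Num.max 0 ((1 - l) * z + l * z') ^+ 2 <=
  (1 - l) ^+ 2 * Num.max 0 z ^+ 2 + 2 * l * (1 - l) * (Num.max 0 z * z')
  + l ^+ 2 * z' ^+ 2.
Proof.
move=> /andP[l0 l1].
have -> : (1 - l) ^+ 2 * Num.max 0 z ^+ 2
    + 2 * l * (1 - l) * (Num.max 0 z * z') + l ^+ 2 * z' ^+ 2
  = ((1 - l) * Num.max 0 z + l * z') ^+ 2 by ring.
case: (leP 0 ((1 - l) * z + l * z')) => [h|_]; last first.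
  by rewrite expr0n sqr_ge0.
rewrite ler_pXn2r ?nnegrE//.
- by rewrite lerD2r ler_wpM2l ?subr_ge0// le_max lexx orbT.
- apply: le_trans h _.
  by rewrite lerD2r ler_wpM2l ?subr_ge0// le_max lexx orbT.
Qed.

(* Blackwell's approachability argument: the squared distance of the payoff
   vector to the negative orthant drops by a fixed amount when [y] is mixed
   with a reply to the weights proportional to the positive parts. *)
Lemma approach_negative_orthant (I : finType) (Y : Type) (g : I -> Y -> R)
    (B : R) (y0 : Y)
    (bounded : forall i y, `|g i y| <= B)
    (mix : forall y1 y2 l, 0 <= l <= 1 ->
       exists y, forall i, g i y = (1 - l) * g i y1 + l * g i y2)
    (reply : forall mu : dist R I, exists y, \sum_i mu i * g i y <= 0) :
  forall e, 0 < e -> exists y, forall i, g i y <= e.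
Proof.
move=> e e0; apply/not_existsP => noy.
pose d y := \sum_i Num.max 0 (g i y) ^+ 2.
have d_ge y : e ^+ 2 <= d y.
  have /existsNP[i /negP] := noy y; rewrite -ltNge => gt_e.
  rewrite /d (bigD1 i)//= -[leLHS]addr0 lerD ?sumr_ge0//; last first.
    by move=> j _; exact: sqr_ge0.
  rewrite ler_pXn2r ?nnegrE ?le_max ?lexx ?(ltW e0)//.
  by rewrite (ltW gt_e) orbT.
pose C := \sum_(i : I) B ^+ 2.
have sumC y : \sum_i g i y ^+ 2 <= C.
  apply: ler_sum => i _.
  rewrite -[g i y ^+ 2]real_normK ?num_real//.
  by rewrite ler_pXn2r ?nnegrE// (le_trans _ (bounded i y)).
have d_le y : d y <= C.
  apply: le_trans (sumC y); apply: ler_sum => i _.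
  by case: (leP 0 (g i y)) => // _; rewrite expr0n sqr_ge0.
have C0 : 0 < C.
  by rewrite (lt_le_trans _ (d_le y0))// (lt_le_trans _ (d_ge y0))// exprn_gt0.
(* With this step size the second-order terms [2 * l ^+ 2 * C] amount to [l * e ^+ 2], half of the
   first-order gain [2 * l * e ^+ 2]. *)
pose l := e ^+ 2 / (2 * C).
have e2C : e ^+ 2 <= C by apply: le_trans (d_ge y0) (d_le y0).
have e20 : 0 < e ^+ 2 by rewrite exprn_gt0.
have l0 : 0 < l by rewrite divr_gt0// mulr_gt0.
have l1 : l <= 1 by rewrite ler_pdivrMr ?mulr_gt0// mul1r; lra.
have lC : l * C * 2 = e ^+ 2.
  by rewrite /l; field; rewrite gt_eqF.
have step y : exists y', d y' <= d y - l * e ^+ 2.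
  pose s := \sum_i Num.max 0 (g i y).
  have s0 : 0 < s.
    have /existsNP[i /negP] := noy y; rewrite -ltNge => gt_e.
    rewrite /s (bigD1 i)//= ltr_pwDl//.
      by rewrite lt_max (lt_trans e0 gt_e) orbT.
    by rewrite sumr_ge0// => j _; rewrite le_max lexx.
  have mu0 i : 0 <= Num.max 0 (g i y) / s.
    by rewrite divr_ge0 ?(ltW s0)// le_max lexx.
  have mu1 : \sum_i Num.max 0 (g i y) / s = 1.
    by rewrite -mulr_suml divff// gt_eqF.
  have [y' hy'] := reply (Dist mu0 mu1).
  have {}hy' : \sum_i Num.max 0 (g i y) * g i y' <= 0.
    move: hy'; rewrite /= (_ : \sum_i _ = s^-1 * \sum_i Num.max 0 (g i y) * g i y').
      by rewrite pmulr_rle0// invr_gt0.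
    by rewrite mulr_sumr; apply: eq_bigr => i _; rewrite mulrAC mulrC.
  have l01 : 0 <= l <= 1 by rewrite ltW.
  have [y'' hy''] := mix y y' l l01.
  exists y''.
  have : d y'' <= (1 - l) ^+ 2 * d y
      + 2 * l * (1 - l) * (\sum_i Num.max 0 (g i y) * g i y')
      + l ^+ 2 * \sum_i g i y' ^+ 2.
    rewrite /d !mulr_sumr -!big_split/=; apply: ler_sum => i _.
    by rewrite hy''; exact: sq_pos_part_mix.
  move=> /le_trans; apply.
  have hl : 0 <= 2 * l * (1 - l) by rewrite mulr_ge0 ?subr_ge0// mulr_ge0// ltW.
  have h1 := mulr_ge0_le0 hl hy'.
  have h2 : l ^+ 2 * \sum_i g i y' ^+ 2 <= l ^+ 2 * C by rewrite ler_wpM2l ?sqr_ge0.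
  have h3 : (1 - l) ^+ 2 * d y <= d y - 2 * l * e ^+ 2 + l ^+ 2 * C.
    have -> : (1 - l) ^+ 2 * d y = d y - 2 * l * d y + l ^+ 2 * d y by ring.
    rewrite lerD//; last by rewrite ler_wpM2l ?sqr_ge0.
    by rewrite lerD2l lerN2 ler_wpM2l// mulr_ge0// ltW.
  have h4 : l ^+ 2 * C + l ^+ 2 * C = l * e ^+ 2.
    by rewrite -lC; ring.
  lra.
have ind : has_inf (range d).
  split; first by exists (d y0); exists y0.
  by exists 0 => _ [y _ <-]; exact: le_trans (ltW e20) (d_ge y).
have le2 : 0 < l * e ^+ 2 by rewrite mulr_gt0.
(* A point within [l * e ^+ 2] of the infimum of [d] is carried by [step] strictly below that
   infimum. *)
have [_ [y _ <-] hy] := inf_adherent le2 ind.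
have [y' hy'] := step y.
have : inf (range d) <= d y' by apply: ge_inf; [exact: ind.2 | exists y'].
lra.
Qed.

(** Value expressed by e-optimal strategies on both sides: optimal strategies need not exist, and
    this form is stable under uniformly small changes of the payoff. *)
Definition approx_value (X Y : Type) (V : X -> Y -> \bar R) (v : R) :=
  forall e, 0 < e ->
    (exists x, forall y, (v - e)%:E <= V x y)%E /\
    (exists y, forall x, V x y <= (v + e)%:E)%E.

(** The value is the supremum [v] of the guarantees of the first player. For the second player, the
    net leaves finitely many opposing strategies, and approachability keeps all their payoffs below
    [v] up to a small error. *)
Lemma approx_minimax (X Y : Type) (V : X -> Y -> R) (B : R) (x0 : X) (y0 : Y)
    (bounded : forall x y, `|V x y| <= B)
    (net : forall e, 0 < e -> exists (I : finType) (f : I -> X),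
       forall x, exists i, forall y, V x y <= V (f i) y + e)
    (mixX : forall (I : finType) (f : I -> X) (mu : dist R I),
       exists x, forall y, V x y = \sum_i mu i * V (f i) y)
    (mixY : forall y1 y2 l, 0 <= l <= 1 ->
       exists y, forall x, V x y = (1 - l) * V x y1 + l * V x y2) :
  exists v, approx_value (fun x y => (V x y)%:E) v.
Proof.
pose m x := inf (range (V x)).
have hm x : has_inf (range (V x)).
  split; first by exists (V x y0); exists y0.
  by exists (- B) => _ [y _ <-]; have := bounded x y; rewrite ler_norml => /andP[].
have m_le x y : m x <= V x y by apply: ge_inf; [exact: (hm x).2 | exists y].
have hs : has_sup (range m).
  split; first by exists (m x0); exists x0.
  exists B => _ [x _ <-]; apply: le_trans (m_le x y0) _.
  by have := bounded x y0; rewrite ler_norml => /andP[].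
exists (sup (range m)) => e e0; split.
  have [_ [x _ <-] hx] := sup_adherent e0 hs.
  exists x => y; rewrite lee_fin; apply: le_trans (ltW hx) _; exact: m_le.
set v := sup _.
(* One third of [e] is spent on the near-best reply, one on approachability and one on the net. *)
have e30 : 0 < e / 3 by rewrite divr_gt0.
have [I [f hf]] := net _ e30.
have [] := @approach_negative_orthant I Y (fun i y => V (f i) y - (v + e / 3))
  (B + `|v + e / 3|) y0 _ _ _ _ e30.
- by move=> i y; rewrite (le_trans (ler_normB _ _))// lerD2r.
- move=> y1 y2 l l01; have [y hy] := mixY y1 y2 l l01; exists y => i.
  by rewrite hy; ring.
(* The mixture by [mu] is itself a strategy [x], so it guarantees at most [v], and a nearly
   minimizing [y] against it is the reply. *)
- move=> mu; have [x hx] := mixX _ f mu.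
  have [_ [y _ <-] hy] := inf_adherent e30 (hm x).
  exists y; under eq_bigr do rewrite mulrBr.
  rewrite sumrB -hx -mulr_suml dist_sum1 mul1r subr_le0.
  apply: le_trans (ltW hy) _; rewrite lerD2r.
  by apply: sup_ubound; [exact: hs.2 | exists x].
- move=> y hy; exists y => x; rewrite lee_fin.
  have [i hi] := hf x.
  apply: le_trans (hi y) _.
  have := hy i; lra.
Qed.

(** The vectors of the [u j x] lie in a cube, which is cut into cells of side [1 / G]. Two
    strategies in one cell have payoffs differing by at most [M / G < e], so one representative for
    each occupied cell suffices. *)
Lemma bilinear_net (X Y : Type) (J : finType) (coef : J -> R)
    (u : J -> X -> R) (w : J -> Y -> R) (x0 : X)
    (u01 : forall j x, 0 <= u j x <= 1) (w01 : forall j y, 0 <= w j y <= 1) :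
  forall e, 0 < e -> exists (I : finType) (f : I -> X),
    forall x, exists i, forall y,
      \sum_j coef j * u j x * w j y <= \sum_j coef j * u j (f i) * w j y + e.
Proof.
move=> e e0.
pose M := \sum_j `|coef j|.
have M0 : 0 <= M by rewrite sumr_ge0.
pose G := (Num.truncn (M / e)).+1.
have G0 : 0 < G%:R :> R by rewrite ltr0n.
have MG : M < e * G%:R.
  rewrite mulrC -ltr_pdivrMr//.
  have /andP[_] := truncn_itv (divr_ge0 M0 (ltW e0)).
  by [].
(* There are [G.+1] levels because [u j x] may equal 1. *)
pose cell x : {ffun J -> 'I_G.+1} := [ffun j => inord (Num.truncn (u j x * G%:R))].
(* Empty cells receive the irrelevant default [x0]. *)
pose f c := if pselect (exists x, cell x = c) is left h then projT1 (cid h) else x0.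
exists {ffun J -> 'I_G.+1}, f => x; exists (cell x) => y.
have fE : cell (f (cell x)) = cell x.
  by rewrite /f; case: pselect => [h|[]]; [exact: projT2 (cid h)|exists x].
set x' := f _ in fE *.
have close j : `|u j x - u j x'| <= G%:R^-1.
  have /ffunP/(_ j) := fE; rewrite !ffunE => /(congr1 val) /=.
  have tl z : (Num.truncn (u j z * G%:R) < G.+1)%N.
    have /andP[h0 h1] := u01 j z.
    rewrite ltnS -(ler_nat R) (le_trans (_ : _ <= u j z * G%:R))//.
      by rewrite truncn_le mulr_ge0// ltW.
    by rewrite ler_piMl// ltW.
  rewrite !inordK// => tE.
  have it z := truncn_itv (mulr_ge0 (andP (u01 j z)).1 (ltW G0)).
  have := it x; have := it x'; rewrite tE.
  move: (Num.truncn _) => t /andP[a1 a2] /andP[a3 a4].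
  rewrite -(ler_pM2r G0) mulVf ?gt_eqF// -[G%:R in leLHS]gtr0_norm// -normrM mulrBl.
  rewrite ler_norml; move: a2 a4; rewrite -natr1 => a2 a4.
  by apply/andP; split; lra.
rewrite -lerBlDl -sumrB.
apply: le_trans (_ : \sum_j `|coef j| * G%:R^-1 <= _); last first.
  by rewrite -mulr_suml ler_pdivrMr// ltW.
apply: ler_sum => j _.
rewrite -mulrBl -mulrBr (le_trans (ler_norm _))// !normrM -mulrA ler_wpM2l//.
have /andP[w0 w1] := w01 j y.
by rewrite -[leRHS]mulr1 ler_pM// ger0_norm.
Qed.

End Minimax.

(** * Behavioral strategies *)

Section Strategies.
Variables (R : realType) (S A B : pfinType).

Lemma dist_le1 (E : finType) (d : dist R E) e : d e <= 1.
Proof.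
by rewrite -(dist_sum1 d) (bigD1 e)//= lerDl sumr_ge0// => *; exact: dist_ge0.
Qed.

(** The identity is multiplied through by the total weight, so that it also covers total weight
    zero, where all weights vanish and [d0] serves. *)
Lemma weighted_mean_dist (E J : finType) (a : J -> R) (d : J -> dist R E)
    (d0 : dist R E) (a0 : forall j, 0 <= a j) :
  exists d' : dist R E, forall e, (\sum_j a j) * d' e = \sum_j a j * d j e.
Proof.
set s := \sum_j a j.
have s0 : 0 <= s by rewrite sumr_ge0.
have [sE|sN] := eqVneq s 0.
  exists d0 => e; rewrite sE mul0r big1// => j _.
  by rewrite (psumr_eq0P (fun i _ => a0 i) sE)// mul0r.
have t0 e : 0 <= s^-1 * \sum_j a j * d j e.
  rewrite mulr_ge0 ?invr_ge0// sumr_ge0// => j _.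
  by rewrite mulr_ge0// dist_ge0.
have t1 : \sum_e s^-1 * \sum_j a j * d j e = 1.
  rewrite -mulr_sumr exchange_big/=.
  under eq_bigr do rewrite -mulr_sumr dist_sum1 mulr1.
  by rewrite mulVf.
by exists (Dist t0 t1) => e /=; rewrite mulVKf.
Qed.

Definition path_hist n (f : nat -> S * A * B) : history S A B n :=
  ([tuple f m | m < n], (f n).1.1).

Lemma eq_path_hist n f g : (forall m, (m <= n)%N -> f m = g m) ->
  path_hist n f = path_hist n g.
Proof.
move=> fg; congr pair; last by rewrite fg.
by apply: eq_from_tnth => m; rewrite !tnth_mktuple fg// ltnW.
Qed.

Section Reach.
Variables (E : finType) (act : S * A * B -> E).

(** One player's factor in the probability of the first [n] letters of a path; [act] selects the
    coordinate that this player controls. *)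
Definition reach (tau : forall n, history S A B n -> dist R E) n f : R :=
  \prod_(m < n) tau m (path_hist m f) (act (f m)).

Lemma reach_itv tau n f : 0 <= reach tau n f <= 1.
Proof.
rewrite prodr_ge0 ?prodr_ile1//= => m _; rewrite dist_ge0//.
by rewrite dist_le1.
Qed.

Lemma reachS tau n f :
  reach tau n.+1 f = reach tau n f * tau n (path_hist n f) (act (f n)).
Proof. by rewrite /reach big_ord_recr. Qed.

Lemma eq_reach tau n f g : (forall m, (m < n)%N -> f m = g m) ->
  reach tau n f = reach tau n g.
Proof.
move=> fg; apply: eq_bigr => m _; rewrite fg//.
by rewrite (@eq_path_hist m f g)// => l lm; rewrite fg// (leq_ltn_trans lm).
Qed.

(* Kuhn's theorem: a mixture of behavioral strategies is
   realized by playing, at each history, the conditional mean given that this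
   history is reached. *)
Lemma reach_mixture (J : finType)
    (tau : J -> forall n, history S A B n -> dist R E) (mu : dist R J) :
  exists t, forall n f, reach t n f = \sum_j mu j * reach (tau j) n f.
Proof.
have [j0] : exists j0 : J, True.
  case: (pickP J) => [j _|J0]; first by exists j.
  have := dist_sum1 mu; rewrite big_pred0// => /eqP.
  by rewrite eq_sym oner_eq0.
(* [hp] rebuilds a path from a history. Its default letter is harmless, since [reach] at length [n]
   reads only letters below [n]. *)
move=> _; pose hp n (h : history S A B n) m := nth (h.2, point, point) h.1 m.
have ex n (h : history S A B n) : exists d' : dist R E, forall e,
    (\sum_j mu j * reach (tau j) n (hp n h)) * d' e =
    \sum_j mu j * reach (tau j) n (hp n h) * tau j n h e.
  apply: weighted_mean_dist; first exact: (tau j0 n h).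
  by move=> j; rewrite mulr_ge0 ?dist_ge0//; case/andP: (reach_itv (tau j) n (hp n h)).
exists (fun n h => projT1 (cid (ex n h))) => n f.
elim: n => [|n IH].
  rewrite {1}/reach big_ord0; under eq_bigr do rewrite /reach big_ord0 mulr1.
  by rewrite dist_sum1.
have hpE j : reach (tau j) n f = reach (tau j) n (hp n (path_hist n f)).
  apply: eq_reach => m mn; rewrite /hp [RHS](_ : _ = nth ((f n).1.1, point, point)
      [tuple f l | l < n] (Ordinal mn))//.
  by rewrite -tnth_nth tnth_mktuple.
rewrite reachS IH; under eq_bigr do rewrite hpE.
rewrite (projT2 (cid (ex n (path_hist n f)))).
by apply: eq_bigr => j _; rewrite reachS -hpE mulrA.
Qed.

End Reach.
End Strategies.

(** * Values and limits of values from e-optimal strategies *)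

Section Values.
Variables (R : realType) (K S A B : pfinType).
Implicit Types V : policy1 R K S A B -> policy2 R S A B -> \bar R.

Lemma approx_value_has_value V v : approx_value V v -> has_value V v.
Proof.
move=> hv.
have lo_up : (lower_value V <= upper_value V)%E.
  apply: ge_ereal_sup => _ [pi _ <-]; apply: le_ereal_inf_tmp => _ [sg _ <-].
  apply: (@le_trans _ _ (V pi sg)).
    by apply: ereal_inf_lbound; exists sg.
  by apply: ereal_sup_ubound; exists pi.
have lo : (v%:E <= lower_value V)%E.
  apply/lee_addgt0Pr => e /hv[[pi hpi] _].
  rewrite -leeBlDr// -EFinB.
  apply: (@le_trans _ _ (ereal_inf (range (fun sg => V pi sg)))).
    by apply: le_ereal_inf_tmp => _ [sg _ <-].
  by apply: ereal_sup_ubound; exists pi.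
have up : (upper_value V <= v%:E)%E.
  apply/lee_addgt0Pr => e /hv[_ [sg hsg]].
  rewrite -EFinD.
  apply: (@le_trans _ _ (ereal_sup (range (fun pi => V pi sg)))).
    by apply: ereal_inf_lbound; exists sg.
  by apply: ge_ereal_sup => _ [pi _ <-].
by split; apply/eqP; rewrite eq_le ?lo ?up ?(le_trans lo_up up) ?(le_trans lo lo_up).
Qed.

(** From [Vn n <= U <= Vn m + d m] follows [vn n <= vn m + d m] for all [n] and [m], so the [vn]
    converge to their supremum. Strategies that are [e / 2]-optimal for [Vn n] with [d n < e / 2]
    are [e]-optimal for [U]. *)
Lemma approx_value_limit (X Y : Type) (U : X -> Y -> \bar R)
    (Vn : nat -> X -> Y -> R) (vn d : nat -> R)
    (Vn_value : forall n, approx_value (fun x y => (Vn n x y)%:E) (vn n))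
    (Vn_le : forall n x y, ((Vn n x y)%:E <= U x y)%E)
    (U_le : forall n x y, (U x y <= (Vn n x y + d n)%:E)%E)
    (d0 : d @ \oo --> 0) :
  exists v, approx_value U v /\ vn @ \oo --> v.
Proof.
have vn_le n m : vn n <= vn m + d m.
  apply/ler_addgt0Pr => e e0.
  have e20 : 0 < e / 2 by rewrite divr_gt0.
  have [[x hx] _] := Vn_value n _ e20; have [_ [y hy]] := Vn_value m _ e20.
  have := le_trans (le_trans (hx y) (Vn_le n x y)) (U_le m x y).
  have := hy x; rewrite !lee_fin; lra.
have hs : has_sup (range vn).
  split; first by exists (vn 0%N); exists 0%N.
  by exists (vn 0%N + d 0%N) => _ [n _ <-].
pose v := sup (range vn).
have v_ge n : vn n <= v by apply: sup_ubound; [exact: hs.2 | exists n].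
have v_le n : v <= vn n + d n.
  by apply: ge_sup; [exact: hs.1 | move=> _ [m _ <-]].
exists v; split; last first.
  apply: (@squeeze_cvgr _ _ _ _ (fun n => v - d n) (fun=> v)).
  - by near=> n; rewrite v_ge lerBlDr v_le.
  - by rewrite -[X in _ --> X]subr0; apply: cvgB => //; exact: cvg_cst.
  - exact: cvg_cst.
move=> e e0; have e20 : 0 < e / 2 by rewrite divr_gt0.
have [n hn] : exists n, d n < e / 2.
  have : \forall n \near \oo, d n < e / 2 by exact: (cvgr_lt 0 d0).
  by move=> /filter_ex.
have [[x hx] [y hy]] := Vn_value n _ e20.
have := v_ge n; have := v_le n => h1 h2.
split.
  exists x => y'; apply: le_trans (Vn_le n x y'); apply: le_trans (hx y').
  by rewrite lee_fin; lra.
exists y => x'; apply: le_trans (U_le n x' y) _.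
by move: (hy x'); rewrite !lee_fin; lra.
Unshelve. all: end_near. Qed.

End Values.

(** * Exponential discounting *)

Section Exponential.
Variables (R : realType) (a : R).
Hypothesis a0 : 0 < a.

Let disc (t : R) : R := expR (- (a * t)).

Lemma measurable_disc d (T : measurableType d) (D : set T) (X : T -> R) :
  measurable_fun D X -> measurable_fun D (fun w => expR (- (a * X w))).
Proof.
move=> mX; apply: measurableT_comp => //; apply: measurableT_comp => //.
exact: measurable_funM.
Qed.

Lemma continuous_disc : continuous disc.
Proof.
move=> z; apply: continuous_comp; last exact: continuous_expR.
by apply: (@continuousN _ R^o); apply: continuousM => //; exact: cst_continuous.
Qed.

Lemma integral_disc_tail (x : R) :
  (\int[lebesgue_measure]_(t in `[x, +oo[) (a * disc t)%:E = (disc x)%:E)%E.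
Proof.
rewrite (@ge0_continuous_FTC2y _ _ (fun t => - disc t) x 0).
- by rewrite EFinN oppeK add0e.
- by move=> t _; rewrite mulr_ge0 ?expR_ge0// ltW.
- apply: continuous_subspaceT => t.
  by apply: continuousM; [exact: cst_continuous|exact: continuous_disc].
- rewrite -oppr0; apply: cvgN.
  rewrite (_ : disc = (fun z => expR (- z)) \o (fun z => a * z))//.
  apply: (@cvg_comp _ _ _ _ _ _ (pinfty_nbhs R)); last exact: cvgr_expR.
  exact: gt0_cvgMry.
- by move=> t _; exact: ex_derive.
- by apply: cvgN; apply/cvg_at_right_filter; exact: continuous_disc.
- move=> t _.
  rewrite derive1_comp// derive1N// derive1_id mulN1r derive1_comp// derive1E.
  have /funeqP -> := @derive_expR R.
  by rewrite derive1N// derive1Ml// derive1_id mulr1 mulrN opprK mulrC.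
Qed.

(** Difference of the two tails at [x] and [y], divided by [a]. *)
Lemma integral_disc (x y : R) : x <= y ->
  (\int[lebesgue_measure]_(t in `[x, y[) (disc t)%:E =
   (a^-1 * (disc x - disc y))%:E)%E.
Proof.
move=> xy.
have mdisc (D : set R) : measurable D ->
    measurable_fun D (fun t => (a * disc t)%:E).
  move=> mD; apply/measurable_EFinP; apply: measurable_funM => //.
  exact: measurable_disc.
have split_y : (\int[lebesgue_measure]_(t in `[x, +oo[) (a * disc t)%:E =
    \int[lebesgue_measure]_(t in `[x, y[) (a * disc t)%:E +
    \int[lebesgue_measure]_(t in `[y, +oo[) (a * disc t)%:E)%E.
  rewrite -ge0_integral_setU//=.
  - congr (integral _ _ _).
    by rewrite -itv_bndbnd_setU// bnd_simp.
  - apply: mdisc; exact: measurableU.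
  - by move=> t _; rewrite lee_fin mulr_ge0 ?expR_ge0// ltW.
  - apply/disj_setPS => t/=; rewrite !in_itv/= andbT => -[/andP[_ ty] yt].
    by move: (lt_le_trans ty yt); rewrite ltxx.
move: split_y; rewrite !integral_disc_tail => split_y.
have : (\int[lebesgue_measure]_(t in `[x, y[) (a * disc t)%:E =
    (disc x - disc y)%:E)%E.
  by rewrite EFinB split_y addeK.
under eq_integral do rewrite EFinM.
rewrite ge0_integralZl//; last 3 first.
- by apply/measurable_EFinP; exact: measurable_disc.
- by move=> t _; rewrite lee_fin expR_ge0.
- by rewrite lee_fin ltW.
move=> E; rewrite EFinM -E muleA -EFinM mulVf ?mul1e//.
by rewrite gt_eqF.
Qed.

(** Write [disc (X w)] as the integral of [a * disc t] over [t >= X w] and exchange the integrals by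
    Tonelli. This reduces discounted expectations to distribution functions, the only data that the
    law of the play provides. *)
Lemma integral_expR_layer_cake d (T : measurableType d)
    (P : {sigma_finite_measure set T -> \bar R}) (D : set T) (h X : T -> R)
    (mD : measurable D) (mh : measurable_fun setT h) (h0 : forall w, 0 <= h w)
    (mX : measurable_fun setT X) (X0 : forall w, 0 <= X w) :
  (\int[P]_(w in D) (h w * disc (X w))%:E =
   \int[lebesgue_measure]_(t in `[0%R, +oo[)
     ((a * disc t)%:E * \int[P]_(w in D `&` [set w | (X w <= t)%R]) (h w)%:E))%E.
Proof.
have mdisc : measurable_fun setT (fun t => a * disc t).
  by apply: measurable_funM => //; exact: measurable_disc.
have mXt t : measurable [set w | X w <= t].
  have := @measurable_lee _ T R setT measurableT (EFin \o X) (cst t%:E).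
  by rewrite setTI; apply => //; exact/measurable_EFinP.
pose G := [set z : T * R | X z.1 <= z.2].
have mG : measurable G.
  have := @measurable_lee _ (T * R)%type R setT measurableT
    (EFin \o (X \o fst)) (EFin \o snd).
  rewrite setTI; apply; apply/measurable_EFinP => //.
  by apply: measurableT_comp => //.
have GE w t : \1_G (w, t) = (X w <= t)%R%:R :> R.
  by rewrite indicE /G mem_setE.
(* Both factors are extended by zero, so that Tonelli applies on the whole product space. *)
pose f := h \_ D.
pose g := (fun t => a * disc t) \_ `[0, +oo[.
have f0 w : 0 <= f w by rewrite /f patchE; case: ifP.
have g0 t : 0 <= g t.
  by rewrite /g patchE; case: ifP => // _; rewrite mulr_ge0 ?expR_ge0// ltW.
have mf : measurable_fun setT f.
  by apply/(measurable_restrictT h mD); exact: measurable_funTS.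
have mg : measurable_fun setT g.
  apply/(measurable_restrictT (fun t => a * disc t) (measurable_itv _)).
  exact: measurable_funTS.
pose F (z : T * R) := (f z.1 * (g z.2 * \1_G z))%:E.
have := @fubini_tonelli _ _ T _ R P lebesgue_measure F.

have mF : measurable_fun setT F.
  apply/measurable_EFinP; apply: measurable_funM; first exact: measurableT_comp.
  apply: measurable_funM; first exact: measurableT_comp.
  exact: measurable_indic.
have F0 z : (0 <= F z)%E by rewrite lee_fin mulr_ge0// mulr_ge0.
move=> /(_ mF F0) FT.
transitivity (\int[P]_w \int[lebesgue_measure]_t F (w, t))%E.
  rewrite integral_mkcond; apply: eq_integral => w _.
  under eq_integral do rewrite /F/= EFinM.
  rewrite ge0_integralZl//; last 3 first.
  - apply/measurable_EFinP; apply: measurable_funM => //.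
    apply: (measurableT_comp _ (pair1_measurable w)).
    exact: measurable_indic.
  - by move=> t _; rewrite lee_fin mulr_ge0.
  - by rewrite lee_fin.
  rewrite /f !patchE; case: ifP => // _; last by rewrite mul0e.
  rewrite EFinM; congr (_ * _)%E.
  rewrite -[LHS]/((disc (X w))%:E) -integral_disc_tail [in LHS]integral_mkcond.
  apply: eq_integral => t _; rewrite GE /g !patchE !mem_setE !in_itv/= !andbT.
  have [Xt|tX] := leP (X w) t; last by rewrite mulr0.
  by rewrite (le_trans (X0 w) Xt) mulr1.
rewrite FT [RHS]integral_mkcond; apply: eq_integral => t _.
rewrite [RHS]patchE; case: ifPn => [t0|tN]; last first.
  rewrite integral0_eq// => w _; rewrite /F/= /g patchE (negbTE tN).
  by rewrite mul0r mulr0.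
rewrite [in RHS]integral_mkcond -ge0_integralZl//; last 3 first.
- apply/(measurable_restrictT (EFin \o h) (measurableI _ _ mD (mXt t))).
  by apply/measurable_EFinP; exact: measurable_funTS.
- by move=> w _; rewrite patchE; case: ifP => // _; rewrite lee_fin.
- by rewrite lee_fin mulr_ge0 ?expR_ge0// ltW.
apply: eq_integral => w _.
rewrite /F/= /f /g !patchE t0 in_setI.
case: (w \in D) => /=; last by rewrite mul0r mule0.
have -> : (w \in [set w | X w <= t]) = (X w <= t) by apply/idP/idP; rewrite inE.
rewrite GE; case: (X w <= t); last by rewrite !mulr0 mule0.
by rewrite mulr1 -EFinM mulrC.
Qed.

End Exponential.

(** * The trajectory space *)

Section Integrals.
Context d (T : measurableType d) (R : realType).
Variable P : {measure set T -> \bar R}.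

Lemma ge0_integral_fibers (I : finType) (phi : T -> I) (D : set T)
    (F : T -> \bar R)
    (mphi : forall i, measurable [set w | phi w = i]) (mD : measurable D)
    (mF : measurable_fun setT F) (F0 : forall w, (0 <= F w)%E) :
  (\int[P]_(w in D) F w =
   \sum_i \int[P]_(w in D `&` [set w | phi w = i]) F w)%E.
Proof.
under eq_bigr do rewrite integral_mkcond.
rewrite integral_mkcond -ge0_integral_sum//; last 2 first.
- move=> i; apply/(measurable_restrictT _ (measurableI _ _ mD (mphi i))).
  exact: measurable_funTS.
- by move=> i w _; rewrite patchE; case: ifP.
apply: eq_integral => w _; rewrite (bigD1 (phi w))//= big1 ?adde0.
  by rewrite !patchE in_setI [_ \in [set _ | _]]mem_set// andbT.
move=> i iw; rewrite patchE ifN// in_setI negb_and; apply/orP; right.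
by apply/negP; rewrite inE/= => /eqP; rewrite eq_sym (negbTE iw).
Qed.

End Integrals.

Section Law.
Variables (R : realType) (K S A B : pfinType).
Local Notation Om := (Omega R K S A B).
Implicit Types (w : Om) (f : nat -> S * A * B).

Lemma measurable_kappa k : measurable [set w : Om | kappa w = k].
Proof. by apply: sub_sigma_algebra; left; exists k. Qed.

Lemma measurable_state n i : measurable [set w : Om | state n w = i].
Proof.
by apply: sub_sigma_algebra; right; exists n; apply: Or41; exists i.
Qed.

Lemma measurable_letter n l : measurable [set w : Om | (w.2 n).1 = l].
Proof.
case: l => [[i a] b].
rewrite (_ : [set w | _] = [set w : Om | state n w = i] `&`
    ([set w : Om | action1 n w = a] `&` [set w : Om | action2 n w = b])).
  apply: measurableI; first exact: measurable_state.
  apply: measurableI; apply: sub_sigma_algebra; right; exists n.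
    by apply: Or42; exists a.
  by apply: Or43; exists b.
apply/seteqP; split => w /=; rewrite /state /action1 /action2.
  by move=> ->.
by case: (w.2 n).1 => [[i' a'] b'] [/= <- [<- <-]].
Qed.

Lemma measurable_sojourn n : measurable_fun setT (sojourn n : Om -> R).
Proof.
move=> _ U mU; rewrite setTI; apply: sub_sigma_algebra; right; exists n.
by apply: Or44; exists U.
Qed.

Lemma measurable_jump_time n : measurable_fun setT (jump_time n : Om -> R).
Proof. by apply: measurable_sum => m; exact: measurable_sojourn. Qed.

Lemma sojourn_ge0 n w : 0 <= sojourn n w.
Proof. by rewrite /sojourn. Qed.

Lemma jump_timeS n w : jump_time n.+1 w = jump_time n w + sojourn n w.
Proof. by rewrite /jump_time big_ord_recr. Qed.

Lemma jump_time_ge0 n w : 0 <= jump_time n w.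
Proof. by rewrite sumr_ge0// => m _; exact: sojourn_ge0. Qed.

(** Only the first [n] values of [f] matter; a total path lets inductions on [n] keep the same
    [f]. *)
Definition cylinder k n f : set Om :=
  [set w | kappa w = k /\ forall m, (m < n)%N -> (w.2 m).1 = f m].

Lemma cylinder0 k f : cylinder k 0 f = [set w | kappa w = k].
Proof. by apply/seteqP; split => [w [//]|w /= <-]. Qed.

Lemma cylinderS k n f :
  cylinder k n.+1 f = cylinder k n f `&` [set w | (w.2 n).1 = f n].
Proof.
apply/seteqP; split => w [/= h1 h2].
  by split; [split=> // m mn; apply: h2; rewrite ltnW|exact: h2].
split; first by case: h1.
by move=> m; rewrite ltnS leq_eqVlt => /orP[/eqP->//|]; case: h1 => _; exact.
Qed.

Lemma measurable_cylinder k n f : measurable (cylinder k n f).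
Proof.
elim: n => [|n IH]; first by rewrite cylinder0; exact: measurable_kappa.
by rewrite cylinderS; apply: measurableI => //; exact: measurable_letter.
Qed.

(** The history at stage [n] contains the [n]-th state but not yet the [n]-th actions, hence a
    cylinder of length [n] cut by that state. *)
Lemma hist_cylinder k n f : cylinder k n f `&` [set w | state n w = (f n).1.1]
  = [set w : Om | kappa w = k] `&` [set w : Om | hist n w = path_hist n f].
Proof.
apply/seteqP; split => w /= -[].
  move=> [-> h] sE; split => //; congr pair => //.
  by apply: eq_from_tnth => m; rewrite !tnth_mktuple h.
move=> kE hE; split; last exact: (congr1 snd hE).
split => // m mn.
have := congr1 (fun h : history S A B n => tnth h.1 (Ordinal mn)) hE.
by rewrite !tnth_mktuple.
Qed.

Section Info.
Variable n : nat.

Lemma infoI (D E : set Om) : info n D -> info n E -> info n (D `&` E).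
Proof. by move=> mD mE; exact: (@measurableI _ (g_sigma_algebraType _)). Qed.

Lemma info_actionsI (D E : set Om) :
  info_actions n D -> info_actions n E -> info_actions n (D `&` E).
Proof. by move=> mD mE; exact: (@measurableI _ (g_sigma_algebraType _)). Qed.

(** These are the test events for the conditional law of the actions in [law_actions]. *)
Lemma info_hist k f u :
  info n (cylinder k n f `&` [set w | state n w = (f n).1.1]
          `&` [set w : Om | jump_time n w <= u]).
Proof.
rewrite hist_cylinder; apply: infoI; first apply: infoI.
- by apply: sub_sigma_algebra; apply: Or31; exists k.
- by apply: sub_sigma_algebra; apply: Or32; exists (path_hist n f).
- apply: sub_sigma_algebra; apply: Or33; exists `]-oo, u]%classic.
  exact: measurable_itv.
  by apply/seteqP; split => w /=; rewrite in_itv.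
Qed.

(** These are the test events for the conditional law of the jump in [law_jump]. *)
Lemma info_letters k f u :
  info_actions n (cylinder k n.+1 f `&` [set w : Om | jump_time n w <= u]).
Proof.
rewrite (_ : _ `&` _ = (cylinder k n f `&` [set w | state n w = (f n).1.1]
    `&` [set w : Om | jump_time n w <= u]) `&`
    ([set w : Om | action1 n w = (f n).1.2] `&`
     [set w : Om | action2 n w = (f n).2])).
  apply: info_actionsI.
    by apply: sub_sigma_algebra; apply: Or31; exact: info_hist.
  apply: info_actionsI; apply: sub_sigma_algebra.
    by apply: Or32; exists (f n).1.2.
  by apply: Or33; exists (f n).2.
rewrite cylinderS /state /action1 /action2; apply/seteqP; split => w /=.
  by move=> [[? ->]].
move=> [[[h1 h2] h3] [h4 h5]]; do 2 split => //.
by move: h2 h4 h5; case: (w.2 n).1 (f n) => [[? ?] ?] [[? ?] ?] /= -> -> ->.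
Qed.

End Info.
End Law.

(** * Discounted weights of paths *)

Section Kernel.
Variables (R : realType) (S A B : pfinType) (Q : R -> S -> S -> A -> B -> R).
Hypothesis Q_kernel : semi_markov_kernel Q.
Variable alpha : R.
Hypothesis alpha_gt0 : 0 < alpha.

(* The Laplace transform of Q(dt, j | i, a, b) at [alpha], integrated by parts. *)
Definition laplace (l : S * A * B) (j : S) : R :=
  fine (\int[lebesgue_measure]_(t in `[0%R, +oo[)
    ((alpha * expR (- (alpha * t))) * Q t j l.1.1 l.1.2 l.2)%:E).

Lemma measurable_kernel j i a b :
  measurable_fun (`[0, +oo[ : set R) (fun t : R => Q t j i a b).
Proof.
(* The kernel is monotone only on nonnegative times; freezing it at its value at 0 for negative
   times makes it monotone on the whole line. *)
apply: (@eq_measurable_fun _ _ _ _ _ (fun t : R => Q (Num.max 0 t) j i a b)).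
  move=> t; rewrite inE/= in_itv/= andbT => t0.
  by rewrite (max_idPr t0).
apply: nondecreasing_measurable => // s t st.
apply: (smk_nondecreasing Q_kernel); first by rewrite le_max lexx.
by rewrite le_max2.
Qed.

Variables delta epsilon : R.
Hypotheses (delta_gt0 : 0 < delta) (epsilon_gt0 : 0 < epsilon).
Hypothesis regular : forall i a b, sojourn_cdf Q delta i a b <= 1 - epsilon.

(** Laplace transform at [alpha] of the distribution function equal to [1 - epsilon] on [0, delta)
    and to 1 afterwards, which dominates every sojourn distribution function. It bounds the expected
    discount over one stage. *)
Definition laplace_bound : R := 1 - epsilon * (1 - expR (- (alpha * delta))).

Lemma laplace_bound_lt1 : laplace_bound < 1.
Proof.
rewrite /laplace_bound gtrBl mulr_gt0// subr_gt0 expR_lt1.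
by rewrite oppr_lt0 mulr_gt0.
Qed.

Let ker (l : S * A * B) j t : \bar R :=
  ((alpha * expR (- (alpha * t))) * Q t j l.1.1 l.1.2 l.2)%:E.

Lemma integral_laplace_le l :
  (\sum_j \int[lebesgue_measure]_(t in `[0%R, +oo[) ker l j t
   <= laplace_bound%:E)%E.
Proof.
have mdisc (D : set R) : measurable D ->
    measurable_fun D (fun t => alpha * expR (- (alpha * t))).
  by move=> mD; apply: measurable_funM => //; exact: measurable_disc.
have disc0 t : 0 <= alpha * expR (- (alpha * t)) by rewrite mulr_ge0 ?expR_ge0// ltW.
rewrite -ge0_integral_sum//; last 2 first.
- move=> j; apply/measurable_EFinP; apply: measurable_funM; first exact: mdisc.
  exact: measurable_kernel.
- move=> j t; rewrite /= in_itv/= andbT => t0.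
  by rewrite lee_fin mulr_ge0// (smk_ge0 Q_kernel).
pose g t : R := (alpha * expR (- (alpha * t))) *
  ((1 - epsilon) + epsilon * \1_(`[delta, +oo[%classic : set R) t).
have eps1 : 0 <= 1 - epsilon.
  apply: le_trans (regular l.1.1 l.1.2 l.2); rewrite /sojourn_cdf sumr_ge0// => j _.
  by rewrite (smk_ge0 Q_kernel)// ltW.
have mg : measurable_fun setT (fun t => \1_(`[delta, +oo[%classic : set R) t : R).
  exact: measurable_indic.
apply: (@le_trans _ _ (\int[lebesgue_measure]_(t in `[0%R, +oo[) (g t)%:E)%E).
  apply: ge0_le_integral => //.
  - move=> t; rewrite /= in_itv/= andbT => t0; apply: sume_ge0 => j _.
    by rewrite lee_fin mulr_ge0// (smk_ge0 Q_kernel).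
  - apply: emeasurable_sum => j; apply/measurable_EFinP; apply: measurable_funM.
      exact: mdisc.
    exact: measurable_kernel.
  - apply/measurable_EFinP; apply: measurable_funM; first exact: mdisc.
    apply: measurable_funD => //; apply: measurable_funM => //.
  - move=> t; rewrite /= in_itv/= andbT => t0.
    rewrite /ker sumEFin lee_fin -mulr_sumr /g ler_wpM2l//.
    rewrite indicE mem_setE in_itv/= andbT.
    have [dt|td] := leP delta t.
      rewrite mulr1 subrK; exact: (smk_sum_le1 Q_kernel).
    (* Before [delta], monotonicity in time carries the bound over from [delta]. *)
    rewrite mulr0 addr0; apply: le_trans (regular l.1.1 l.1.2 l.2).
    by apply: ler_sum => j _; apply: (smk_nondecreasing Q_kernel) => //; exact: ltW.
pose e1 t := (alpha * expR (- (alpha * t)))%:E.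
have -> : (\int[lebesgue_measure]_(t in `[0%R, +oo[) (g t)%:E =
    (1 - epsilon)%:E * (\int[lebesgue_measure]_(t in `[0%R, +oo[) e1 t) +
    epsilon%:E * (\int[lebesgue_measure]_(t in `[0%R, +oo[)
       (e1 t * (\1_(`[delta, +oo[%classic : set R) t)%:E)))%E.
  have me2 : measurable_fun (`[0, +oo[ : set R)
      (fun t => e1 t * (\1_(`[delta, +oo[%classic : set R) t)%:E)%E.
    apply/measurable_EFinP; apply: measurable_funM; first exact: mdisc.
    exact: measurable_funTS mg.
  have me1 : measurable_fun (`[0, +oo[ : set R) e1.
    by apply/measurable_EFinP; exact: mdisc.
  have e20 t : (0 <= e1 t * (\1_(`[delta, +oo[%classic : set R) t)%:E)%E.
    by rewrite /e1 -EFinM lee_fin mulr_ge0.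
  rewrite -!ge0_integralZl ?lee_fin ?(ltW epsilon_gt0)//; last first.
    by move=> t _; rewrite lee_fin.
  rewrite -ge0_integralD//.
  - apply: eq_integral => t _; rewrite /g /e1 -!EFinM -EFinD; congr EFin; ring.
  - by move=> t _; rewrite /e1 -EFinM lee_fin mulr_ge0.
  - exact: measurable_funeM.
  - by move=> t _; rewrite mule_ge0 ?e20 ?lee_fin// ltW.
  - exact: measurable_funeM.
have -> : (\int[lebesgue_measure]_(t in `[0%R, +oo[)
       (e1 t * (\1_(`[delta, +oo[%classic : set R) t)%:E)
     = \int[lebesgue_measure]_(t in `[delta, +oo[) e1 t)%E.
  rewrite [LHS]integral_mkcond [RHS]integral_mkcond.
  apply: eq_integral => t _; rewrite !patchE indicE !mem_setE !in_itv/= !andbT.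
  have [dt|td] := leP delta t.
    by rewrite (le_trans (ltW delta_gt0) dt) mule1.
  by rewrite mule0; case: ifP.
rewrite /e1 !integral_disc_tail// mulr0 oppr0 expR0 mule1 -EFinM -EFinD lee_fin.
by rewrite /laplace_bound; lra.
Qed.

(** The integral is finite, being one term of a nonnegative sum bounded by [laplace_bound], so
    [fine] loses nothing. *)
Lemma laplaceE l j :
  (laplace l j)%:E = (\int[lebesgue_measure]_(t in `[0%R, +oo[) ker l j t)%E.
Proof.
have ker0 j' : (0 <= \int[lebesgue_measure]_(t in `[0%R, +oo[) ker l j' t)%E.
  apply: integral_ge0 => t; rewrite /= in_itv/= andbT => t0.
  by rewrite lee_fin mulr_ge0 ?(smk_ge0 Q_kernel)// mulr_ge0 ?expR_ge0// ltW.
rewrite fineK// ge0_fin_numE//; last exact: ker0.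
apply: le_lt_trans (ltry laplace_bound); apply: le_trans (integral_laplace_le l).
by rewrite (bigD1 j)//= leeDl// sume_ge0// => j' _; exact: ker0.
Qed.

Lemma laplace_ge0 l j : 0 <= laplace l j.
Proof.
rewrite -lee_fin laplaceE; apply: integral_ge0 => t; rewrite /= in_itv/= andbT => t0.
by rewrite lee_fin mulr_ge0 ?(smk_ge0 Q_kernel)// mulr_ge0 ?expR_ge0// ltW.
Qed.

Lemma sum_laplace_le l : \sum_j laplace l j <= laplace_bound.
Proof.
rewrite -lee_fin -sumEFin; under eq_bigr do rewrite laplaceE.
exact: integral_laplace_le.
Qed.

End Kernel.

Section Weights.
Variables (R : realType) (K S A B : pfinType) (Q : R -> S -> S -> A -> B -> R).
Hypothesis Q_kernel : semi_markov_kernel Q.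
Variable alpha : R.
Hypothesis alpha_gt0 : 0 < alpha.
Variables delta epsilon : R.
Hypotheses (delta_gt0 : 0 < delta) (epsilon_gt0 : 0 < epsilon).
Hypothesis regular : forall i a b, sojourn_cdf Q delta i a b <= 1 - epsilon.
Variables (p : dist R K) (i : S) (pi : policy1 R K S A B) (sg : policy2 R S A B).
Local Notation Om := (Omega R K S A B).
Variable P : probability Om R.
Hypothesis law : game_law Q p i pi sg P.
Implicit Types (w : Om) (f : nat -> S * A * B) (D : set Om).

Definition discounted n D : \bar R :=
  (\int[P]_(w in D) (expR (- (alpha * jump_time n w)))%:E)%E.

Let measurable_le n u : measurable [set w : Om | jump_time n w <= u].
Proof.
have := measurable_jump_time (R := R) (K := K) (S := S) (A := A) (B := B) n
  measurableT (measurable_itv `]-oo, u]).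
rewrite setTI; congr (measurable _).
Qed.

Let integral_cst_real D (r : R) :
  measurable D -> (\int[P]_(w in D) r%:E = r%:E * P D)%E.
Proof. by move=> mD; rewrite -integral_cst. Qed.

(** By the layer cake formula, [discounted n D] depends only on the distribution function of the
    jump time on [D], so proportionality passes from one to the other. *)
Lemma discounted_scale n D D' (c : R) (mD : measurable D) (mD' : measurable D') :
  0 <= c ->
  (forall u, P (D `&` [set w | (jump_time n w <= u)%R]) =
     c%:E * P (D' `&` [set w | (jump_time n w <= u)%R]))%E ->
  discounted n D = (c%:E * discounted n D')%E.
Proof.
move=> c0 h; rewrite /discounted.
rewrite -ge0_integralZl ?lee_fin//; last first.
  apply/measurable_EFinP; apply: measurable_disc; apply: measurable_funTS.
  exact: measurable_jump_time.
have := @integral_expR_layer_cake _ _ alpha_gt0 _ _ P D (cst 1) (jump_time n) mD.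
under [in LHS]eq_integral do rewrite mul1r.
move=> ->//; last 2 first.
- exact: measurable_jump_time.
- exact: jump_time_ge0.
under [in RHS]eq_integral do rewrite -EFinM.
rewrite (@integral_expR_layer_cake _ _ alpha_gt0 _ _ P D' (cst c)
  (jump_time n))//; last 2 first.
- exact: measurable_jump_time.
- exact: jump_time_ge0.
apply: eq_integral => t _; congr (_ * _)%E.
rewrite /= !integral_cst_real ?mul1e ?h//; exact: measurableI.
Qed.

Lemma discounted_actions k n f :
  discounted n (cylinder k n.+1 f) =
  ((@pi n k (path_hist n f) (f n).1.2 * @sg n (path_hist n f) (f n).2)%:E *
    discounted n (cylinder k n f `&` [set w | state n w = (f n).1.1]))%E.
Proof.
apply: discounted_scale.
- exact: measurable_cylinder.
- by apply: measurableI; [exact: measurable_cylinder|exact: measurable_state].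
- by rewrite mulr_ge0// dist_ge0.
move=> u.
have [_ /(_ _ (info_hist k f u)) E] := law_actions law n (f n).1.2 (f n).2.
rewrite (_ : cylinder k n.+1 f `&` _ =
  [set w | action1 n w = (f n).1.2 /\ action2 n w = (f n).2] `&`
   (cylinder k n f `&` [set w | state n w = (f n).1.1]
          `&` [set w : Om | jump_time n w <= u])); last first.
  rewrite cylinderS /state /action1 /action2; apply/seteqP; split => w /=.
    by move=> [[? ->]].
  move=> [[h4 h5] [[h1 h2] h3]]; do 2 split => //.
  by move: h2 h4 h5; case: (w.2 n).1 (f n) => [[? ?] ?] [[? ?] ?] /= -> -> ->.
rewrite [LHS]E.
(* On this event the type and the history are fixed, so the conditional probability is a
   constant. *)
under eq_integral => w.
  rewrite hist_cylinder inE => -[[/= -> ->] _].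
  over.
rewrite integral_cst_real//.
apply: measurableI => //; apply: measurableI; first exact: measurable_cylinder.
exact: measurable_state.
Qed.

(** The discount at stage [n.+1] is the discount at stage [n] times that of the sojourn. A layer
    cake in the sojourn yields, for each [t], the factor [Q t j] through [discounted_scale];
    integrating over [t] produces the Laplace transform. *)
Lemma discounted_jump k n f j : 
  discounted n.+1 (cylinder k n.+1 f `&` [set w | state n.+1 w = j]) =
  ((laplace Q alpha (f n) j)%:E * discounted n (cylinder k n.+1 f))%E.
Proof.
have mC := measurable_cylinder (R := R) k n.+1 f.
have mCj : measurable (cylinder k n.+1 f `&` [set w : Om | state n.+1 w = j]).
  by apply: measurableI => //; exact: measurable_state.
have mle t : measurable [set w : Om | sojourn n w <= t].
  have := measurable_sojourn (R := R) (K := K) (S := S) (A := A) (B := B) n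
    measurableT (measurable_itv `]-oo, t]).
  by rewrite setTI.
rewrite /discounted.
under [in LHS]eq_integral do rewrite jump_timeS mulrDr opprD expRD.
rewrite (@integral_expR_layer_cake _ _ alpha_gt0 _ _ P _
  (fun w => expR (- (alpha * jump_time n w))) (sojourn n))//; last 3 first.
- by apply: measurable_disc; exact: measurable_jump_time.
- exact: measurable_sojourn.
- exact: sojourn_ge0.
rewrite (laplaceE Q_kernel alpha_gt0 delta_gt0 epsilon_gt0 regular).
rewrite -ge0_integralZr//; last 3 first.
- apply/measurable_EFinP; apply: measurable_funM.
    by apply: measurable_funM => //; exact: measurable_disc.
  exact: measurable_kernel.
- move=> t; rewrite /= in_itv/= andbT => t0.
  by rewrite lee_fin mulr_ge0 ?(smk_ge0 Q_kernel)// mulr_ge0 ?expR_ge0// ltW.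
- by apply: integral_ge0 => w _; rewrite lee_fin expR_ge0.
apply: eq_integral => t; rewrite inE/= in_itv/= andbT => t0.
rewrite [in RHS]EFinM -[in RHS]muleA; congr (_ * _)%E.
rewrite -!/(discounted n _). apply: discounted_scale => //; first exact: measurableI.
  exact: (smk_ge0 Q_kernel).
move=> u.
have [_ /(_ _ (info_letters k f u)) E] := law_jump law n j t0.
rewrite (_ : _ `&` _ `&` _ `&` _ =
  [set w | jump_time n.+1 w - jump_time n w <= t /\ state n.+1 w = j] `&`
   (cylinder k n.+1 f `&` [set w : Om | jump_time n w <= u])); last first.
  apply/seteqP; split => w /=; rewrite jump_timeS addrAC subrr add0r.
    by move=> [[[? ?] ?] ?].
  by move=> [[? ?] [? ?]].
rewrite [LHS]E.
under eq_integral => w.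
  rewrite inE /state /action1 /action2 => -[[_ /(_ n (ltnSn n)) ->] _].
  over.
by rewrite integral_cst_real//; exact: measurableI.
Qed.

End Weights.

(** * Payoffs *)

Section Pathwise.
Variables (R : realType) (K S A B : pfinType).
Variables (c : K -> S -> A -> B -> R) (alpha : R).
Hypothesis c_ge0 : forall k i a b, 0 <= c k i a b.
Hypothesis alpha_gt0 : 0 < alpha.
Local Notation Om := (Omega R K S A B).
Implicit Type w : Om.

Lemma jump_time_nondecreasing w : nondecreasing_seq (fun n => jump_time n w).
Proof.
apply/nondecreasing_seqP => n; rewrite jump_timeS lerDl; exact: sojourn_ge0.
Qed.

Lemma explosion_time_gt w (t : R) :
  (t%:E < explosion_time w)%E <-> exists n, t < jump_time n w.
Proof.
rewrite /explosion_time (cvg_lim _ (ereal_nondecreasing_cvgn _))//; last first.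
  by move=> m n mn; rewrite lee_fin; exact: jump_time_nondecreasing.
split.
  by move=> /ereal_sup_gt[_ [n _ <-]]; rewrite lte_fin => h; exists n.
move=> [n tn]; apply: (@lt_le_trans _ _ (jump_time n w)%:E).
  by rewrite lte_fin.
by apply: ereal_sup_ubound; exists n.
Qed.

Lemma stage_atE w t m : jump_time m w <= t < jump_time m.+1 w ->
  stage_at t w = m.
Proof.
move=> mt; have lt_stage n n' : jump_time n w <= t -> t < jump_time n'.+1 w ->
    (n <= n')%N.
  move=> h1 h2; rewrite leqNgt; apply/negP => n'n.
  have := le_lt_trans h1 h2; rewrite ltNge.
  by rewrite jump_time_nondecreasing.
have /andP[h1 h2] := mt.
have /= /andP[h3 h4] : [set n | jump_time n w <= t < jump_time n.+1 w] (stage_at t w).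
  by apply: xgetPex; exists m.
by apply/eqP; rewrite eqn_leq !lt_stage.
Qed.

Lemma stage_payoff_ge0 m w : 0 <= stage_payoff c alpha m w.
Proof.
rewrite /stage_payoff mulr_ge0 ?c_ge0// mulr_ge0 ?invr_ge0 ?(ltW alpha_gt0)//.
rewrite subr_ge0 ler_expR lerN2 ler_wpM2l ?(ltW alpha_gt0)//.
exact: jump_time_nondecreasing.
Qed.

(** Time up to explosion is the disjoint union of the intervals between successive jumps, and the
    payoff rate is constant on each of them. *)
Lemma discounted_payoffE w :
  discounted_payoff c alpha w =
  (\sum_(0 <= m <oo) (stage_payoff c alpha m w)%:E)%E.
Proof.
pose I m : set R := `[jump_time m w, jump_time m.+1 w[%classic.
have domE : [set t : R | 0 <= t /\ (t%:E < explosion_time w)%E] = \bigcup_m I m.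
  apply/seteqP; split => t /=.
    move=> [t0 /explosion_time_gt[n tn]].
    have ex : exists n, t < jump_time n w by exists n.
    (* The least [n] with [t] before the [n]-th jump is positive, since the jump times start at 0;
       its predecessor is the current stage. *)
    case: (ex_minnP ex) => -[|m] tm min.
      by move: tm; rewrite /jump_time big_ord0 ltNge t0.
    exists m => //; apply/andP; split => //=; rewrite leNgt; apply/negP => /min.
    by rewrite ltnn.
  move=> [m _]; rewrite /I/= in_itv/= => /andP[mt tm]; split.
    exact: le_trans (jump_time_ge0 m w) mt.
  by apply/explosion_time_gt; exists m.+1.
have onI m t : I m t -> (expR (- (alpha * t)) * payoff_rate_at c (stage_at t w) w)%:E
    = ((payoff_rate_at c m w)%:E * (expR (- (alpha * t)))%:E)%E.
  rewrite /I/= in_itv/= => /stage_atE ->.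
  by rewrite -EFinM mulrC.
have mI m : measurable_fun (I m) (fun t => (expR (- (alpha * t)))%:E).
  by apply/measurable_EFinP; exact: measurable_disc.
rewrite /discounted_payoff domE ge0_integral_bigcup//=.
- apply: eq_eseriesr => m _.
  under eq_integral => t.
    rewrite inE => /onI ->.
    over.
  rewrite ge0_integralZl//; last 3 first.
  + exact: measurable_itv.
  + exact: mI.
  + by rewrite lee_fin c_ge0.
  rewrite integral_disc//; last exact: jump_time_nondecreasing.
  by rewrite -EFinM /stage_payoff mulrC.
- by move=> m; exact: measurable_itv.
- apply/measurable_fun_bigcup; first by move=> m; exact: measurable_itv.
  move=> m; apply: (eq_measurable_fun _
    (fun t (It : t \in I m) => esym (onI m t (set_mem It)))).
  exact: measurable_funeM.
- by move=> t _; rewrite lee_fin mulr_ge0 ?expR_ge0 ?c_ge0.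
- apply/trivIsetP => m n _ _ /eqP mn; apply/seteqP; split => // t [] /=.
  by rewrite /I/= !in_itv/= => /stage_atE h1 /stage_atE h2; apply: mn; rewrite -h1 -h2.
Qed.

End Pathwise.

Lemma measurable_fun_fibers d (T : measurableType d) (R : realType) (I : finType)
    (phi : T -> I) (g : I -> R) :
  (forall i, measurable [set w | phi w = i]) ->
  measurable_fun setT (fun w => g (phi w)).
Proof.
move=> mphi _ U mU; rewrite setTI.
rewrite (_ : _ @^-1` _ = \bigcup_(i in [set i | U (g i)]) [set w | phi w = i]).
  by apply: fin_bigcup_measurable => //; exact: finite_finset.
by apply/seteqP; split => w /=; [move=> h; exists (phi w)|move=> [i Ui ->]].
Qed.

(** * Expected payoffs as finite sums over paths *)

Section Expectations.
Variables (R : realType) (K S A B : pfinType) (Q : R -> S -> S -> A -> B -> R).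
Variables (c : K -> S -> A -> B -> R) (alpha : R).
Hypothesis Q_kernel : semi_markov_kernel Q.
Hypothesis c_ge0 : forall k i a b, 0 <= c k i a b.
Hypothesis alpha_gt0 : 0 < alpha.
Variables delta epsilon : R.
Hypotheses (delta_gt0 : 0 < delta) (epsilon_gt0 : 0 < epsilon).
Hypothesis regular : forall i a b, sojourn_cdf Q delta i a b <= 1 - epsilon.
Variables (p : dist R K) (i : S).
Local Notation Om := (Omega R K S A B).
Implicit Types (w : Om) (f : nat -> S * A * B) (D : set Om).

(** The factor of a path that neither player controls. Letters 0 to [n] involve only [n] jumps,
    whereas each player acts [n.+1] times. *)
Definition nature_weight k n f : R :=
  p k * (i == (f 0%N).1.1)%:R * \prod_(m < n) laplace Q alpha (f m) (f m.+1).1.1.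

Definition path_weight (pi : policy1 R K S A B) (sg : policy2 R S A B) k n f : R :=
  nature_weight k n f * reach (fun l => l.1.2) (fun n => @pi n k) n.+1 f *
  reach (fun l => l.2) sg n.+1 f.

Lemma path_weight_ge0 pi sg k n f : 0 <= path_weight pi sg k n f.
Proof.
rewrite /path_weight mulr_ge0 ?(andP (reach_itv _ _ _ _)).1//.
rewrite mulr_ge0 ?(andP (reach_itv _ _ _ _)).1//.
rewrite /nature_weight mulr_ge0 ?mulr_ge0 ?dist_ge0//.
rewrite prodr_ge0// => m _.
exact: (laplace_ge0 Q_kernel alpha_gt0 delta_gt0 epsilon_gt0 regular).
Qed.

Definition path_of n (x : K * n.+1.-tuple (S * A * B)) : nat -> S * A * B :=
  nth (point, point, point) x.2.

Definition path_event n (x : K * n.+1.-tuple (S * A * B)) : set Om :=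
  cylinder x.1 n.+1 (path_of x).

(** Equals [alpha] times the expected discounted length of a sojourn that follows the letter [l]. *)
Definition exit_rate (l : S * A * B) : R := 1 - \sum_j laplace Q alpha l j.

Section Play.
Variables (pi : policy1 R K S A B) (sg : policy2 R S A B) (P : probability Om R).
Hypothesis law : game_law Q p i pi sg P.

Local Notation disc := (discounted alpha P).
Local Notation wt n x := (path_weight pi sg x.1 n (path_of x)).

Lemma discounted0 D : measurable D -> disc 0%N D = P D.
Proof.
move=> mD; rewrite /discounted.
under eq_integral do rewrite /jump_time big_ord0 mulr0 oppr0 expR0.
by rewrite integral_cst// mul1e.
Qed.

(** The prescribed masses at the initial state [i] already sum to 1 over the types, so any other
    initial state is null. *)
Lemma initial_law k j :
  P [set w | kappa w = k /\ state 0 w = j] = (p k * (i == j)%:R)%:E.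
Proof.
have [<-|ij] := eqVneq i j.
  rewrite mulr1 -(law_init law); congr (P _).
  by apply/seteqP; split => w /= [].
have : P [set w | state 0 w = i] = 1%E.
  rewrite -[LHS]mul1e -integral_cst; last exact: measurable_state.
  rewrite (ge0_integral_fibers P (phi := @kappa R K S A B))//; last 2 first.
  - exact: measurable_kappa.
  - exact: measurable_state.
  transitivity (\sum_k (p k)%:E)%E; last by rewrite sumEFin dist_sum1.
  apply: eq_bigr => k' _.
  rewrite integral_cst; last first.
    by apply: measurableI; [exact: measurable_state|exact: measurable_kappa].
  by rewrite mul1e; exact: (law_init law).
move=> P1; rewrite mulr0; apply/eqP; rewrite eq_le measure_ge0 andbT.
apply: (@le_trans _ _ (P (~` [set w | state 0 w = i]))); last first.
  rewrite probability_setC; last exact: measurable_state.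
  by rewrite [X in (_ - X)%E]P1 subee.
apply: le_measure; rewrite ?inE.
- by apply: measurableI; [exact: measurable_kappa|exact: measurable_state].
- by apply: measurableC; exact: measurable_state.
- by move=> w /= [_ ->] ji; rewrite ji eqxx in ij.
Qed.

(** Induction alternating the two one-step rules; the induction hypothesis concerns the moment when
    the [n]-th state is known and the actions are still to be drawn. *)
Lemma discounted_cylinder k n f :
  disc n (cylinder k n.+1 f) = (path_weight pi sg k n f)%:E.
Proof.
rewrite (discounted_actions alpha_gt0 law).
have -> : disc n (cylinder k n f `&` [set w | state n w = (f n).1.1]) =
    (nature_weight k n f * reach (fun l => l.1.2) (fun n => @pi n k) n f *
     reach (fun l => l.2) sg n f)%:E.
  elim: n => [|n IH].
    rewrite cylinder0 discounted0; last first.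
      by apply: measurableI; [exact: measurable_kappa|exact: measurable_state].
    rewrite [LHS]initial_law /nature_weight /reach !big_ord0.
    by rewrite !mulr1.
  rewrite (discounted_jump Q_kernel alpha_gt0 delta_gt0 epsilon_gt0 regular law).
  rewrite (discounted_actions alpha_gt0 law) IH -!EFinM; congr EFin.
  by rewrite /nature_weight !reachS big_ord_recr/=; ring.
by rewrite -EFinM /path_weight !reachS; congr EFin; ring.
Qed.

Lemma measurable_path_event n (x : K * n.+1.-tuple (S * A * B)) :
  measurable (path_event x).
Proof. exact: measurable_cylinder. Qed.

Lemma integral_path_events n (F : Om -> \bar R)
    (mF : measurable_fun setT F) (F0 : forall w, (0 <= F w)%E) :
  (\int[P]_w F w = \sum_(x : K * n.+1.-tuple (S * A * B))
     \int[P]_(w in path_event x) F w)%E.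
Proof.
pose phi w := (kappa w, [tuple (w.2 l).1 | l < n.+1]).
have phiE x : [set w | phi w = x] = path_event x.
  case: x => k t; apply/seteqP; split => w /=.
    move=> [<- <-]; split => // m mn; rewrite /path_of/=.
    rewrite [RHS](_ : _ = nth (point, point, point)
      [tuple (w.2 l).1 | l < n.+1] (Ordinal mn))//.
    by rewrite -tnth_nth tnth_mktuple.
  move=> [/= kE h]; congr pair => //; apply: eq_from_tnth => m.
  by rewrite tnth_mktuple h// /path_of/= (tnth_nth (point, point, point)).
rewrite (ge0_integral_fibers P (phi := phi))//.
  by apply: eq_bigr => x _; rewrite setTI phiE.
by move=> x; rewrite phiE; exact: measurable_path_event.
Qed.

Lemma discountedS_path_event n x :
  disc n.+1 (@path_event n x) =
  ((\sum_j laplace Q alpha (path_of x n) j) * wt n x)%:E.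
Proof.
rewrite /discounted (ge0_integral_fibers P (phi := @state R K S A B n.+1))//;
  last 3 first.
- exact: measurable_state.
- exact: measurable_path_event.
- apply/measurable_EFinP; apply: measurable_disc; exact: measurable_jump_time.
rewrite mulr_suml -sumEFin; apply: eq_bigr => j _.
rewrite EFinM -discounted_cylinder.
exact: (discounted_jump Q_kernel alpha_gt0 delta_gt0 epsilon_gt0 regular law).
Qed.

Let m_disc n :
  measurable_fun setT (fun w : Om => (expR (- (alpha * jump_time n w)))%:E).
Proof.
by apply/measurable_EFinP; apply: measurable_disc; exact: measurable_jump_time.
Qed.

Lemma discountedT n :
  disc n setT = (\sum_(x : K * n.+1.-tuple (S * A * B)) wt n x)%:E.
Proof.
rewrite /discounted (integral_path_events n)//.
by rewrite -sumEFin; apply: eq_bigr => x _; exact: discounted_cylinder.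
Qed.

Lemma discountedST n : disc n.+1 setT =
  (\sum_(x : K * n.+1.-tuple (S * A * B))
    (\sum_j laplace Q alpha (path_of x n) j) * wt n x)%:E.
Proof.
rewrite /discounted (integral_path_events n)//.
by rewrite -sumEFin; apply: eq_bigr => x _; exact: discountedS_path_event.
Qed.

Lemma measurable_stage_payoff n :
  measurable_fun setT (fun w : Om => stage_payoff c alpha n w).
Proof.
apply: measurable_funM.
  apply: measurable_funM => //; apply: measurable_funB; apply: measurable_disc;
    exact: measurable_jump_time.
apply: (@measurable_fun_fibers _ Om R (K * (S * A * B))%type
  (fun w => (kappa w, (w.2 n).1))
  (fun x => c x.1 x.2.1.1 x.2.1.2 x.2.2)) => -[k l].
rewrite (_ : [set w | _] = [set w : Om | kappa w = k] `&` [set w : Om | (w.2 n).1 = l]).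
  by apply: measurableI; [exact: measurable_kappa|exact: measurable_letter].
by apply/seteqP; split => w /= [-> ->].
Qed.

(** On a path event the payoff rate is constant, so only the drop of the discount between jumps [n]
    and [n.+1] is integrated; it is the path weight times [exit_rate]. *)
Lemma expected_stage_payoff n :
  ('E_P[stage_payoff c alpha n] =
  (\sum_(x : K * n.+1.-tuple (S * A * B))
    let l := path_of x n in
    alpha^-1 * c x.1 l.1.1 l.1.2 l.2 * exit_rate l * wt n x)%:E)%E.
Proof.
rewrite unlock (integral_path_events n); last 2 first.
- by apply/measurable_EFinP; exact: measurable_stage_payoff.
- by move=> w; rewrite lee_fin; exact: stage_payoff_ge0.
rewrite -sumEFin; apply: eq_bigr => x _ /=.
set l := path_of x n; set r := alpha^-1 * c _ _ _ _.
have r0 : 0 <= r by rewrite mulr_ge0 ?c_ge0// invr_ge0 ltW.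
pose dd w := expR (- (alpha * jump_time n w)) - expR (- (alpha * jump_time n.+1 w)).
have dd0 w : 0 <= dd w.
  rewrite subr_ge0 ler_expR lerN2 ler_wpM2l ?(ltW alpha_gt0)//.
  exact: jump_time_nondecreasing.
have mdd : measurable_fun setT dd.
  by apply: measurable_funB; apply: measurable_disc; exact: measurable_jump_time.
have mx := measurable_path_event x.
transitivity (\int[P]_(w in path_event x) (r%:E * (dd w)%:E))%E.
  apply: eq_integral => w; rewrite inE => -[kx hx].
  rewrite -EFinM /stage_payoff /payoff_rate_at /state /action1 /action2 kx hx//.
  by rewrite /r /dd -/l; congr EFin; ring.
rewrite ge0_integralZl//; last 2 first.
- by apply/measurable_EFinP; exact: measurable_funTS.
- by move=> w _; rewrite lee_fin.
(* Additivity is applied to nonnegative integrands, and the subtraction comes only once the terms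
   are known to be finite. *)
have : (\int[P]_(w in path_event x) (dd w)%:E + disc n.+1 (path_event x) =
    disc n (path_event x))%E.
  rewrite -ge0_integralD//.
  - by apply: eq_integral => w _; rewrite -EFinD /dd subrK.
  - by move=> w _; rewrite lee_fin.
  - by apply/measurable_EFinP; exact: measurable_funTS.
  - exact: measurable_funTS.
rewrite discountedS_path_event discounted_cylinder => E.
have -> : (\int[P]_(w in path_event x) (dd w)%:E = (exit_rate l * wt n x)%:E)%E.
  rewrite /exit_rate mulrBl mul1r EFinB -E.
  by rewrite addeK.
by rewrite -EFinM mulrA.
Qed.

End Play.
End Expectations.

(** * Truncated games, the tail estimate and the value *)

Section Game.
Variables (R : realType) (K S A B : pfinType) (Q : R -> S -> S -> A -> B -> R).
Variables (c : K -> S -> A -> B -> R) (alpha : R).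
Hypothesis Q_kernel : semi_markov_kernel Q.
Hypothesis c_ge0 : forall k i a b, 0 <= c k i a b.
Hypothesis alpha_gt0 : 0 < alpha.
Variables delta epsilon : R.
Hypotheses (delta_gt0 : 0 < delta) (epsilon_gt0 : 0 < epsilon).
Hypothesis regular : forall i a b, sojourn_cdf Q delta i a b <= 1 - epsilon.
Variables (p : dist R K) (i : S).
Local Notation Om := (Omega R K S A B).
Local Notation beta := (laplace_bound alpha delta epsilon).

(** The expected stage payoff as a function of the strategies alone, with no reference to the law of
    the play. *)
Definition stage_value (pi : policy1 R K S A B) (sg : policy2 R S A B) n : R :=
  \sum_(x : K * n.+1.-tuple (S * A * B))
    let l := path_of x n in
    alpha^-1 * c x.1 l.1.1 l.1.2 l.2 * exit_rate Q alpha l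
      * path_weight Q alpha p i pi sg x.1 n (path_of x).

Definition truncated_value n pi sg : R := \sum_(m < n.+1) stage_value pi sg m.

(** The sum over all arguments is a crude substitute for the maximum of [c]. *)
Definition payoff_bound : R :=
  alpha^-1 * \sum_(x : K * (S * A * B)) c x.1 x.2.1.1 x.2.1.2 x.2.2.

Lemma payoff_bound_ge k l : alpha^-1 * c k l.1.1 l.1.2 l.2 <= payoff_bound.
Proof.
rewrite /payoff_bound ler_wpM2l ?invr_ge0 ?(ltW alpha_gt0)//.
by rewrite (bigD1 (k, l))//= lerDl sumr_ge0.
Qed.

Lemma payoff_bound_ge0 : 0 <= payoff_bound.
Proof. by rewrite mulr_ge0 ?invr_ge0 ?(ltW alpha_gt0)// sumr_ge0. Qed.

Let lap_ge0 := laplace_ge0 Q_kernel alpha_gt0 delta_gt0 epsilon_gt0 regular.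
Let lap_le := sum_laplace_le Q_kernel alpha_gt0 delta_gt0 epsilon_gt0 regular.

Lemma laplace_bound_ge0 : 0 <= beta.
Proof.
apply: le_trans (lap_le (point, point, point)).
by rewrite sumr_ge0.
Qed.

Lemma exit_rate_ge0 l : 0 <= exit_rate Q alpha l.
Proof.
rewrite subr_ge0 (le_trans (lap_le l))// ltW//.
exact: laplace_bound_lt1.
Qed.

Section Play.
Variables (pi : policy1 R K S A B) (sg : policy2 R S A B) (P : probability Om R).
Hypothesis law : game_law Q p i pi sg P.

Let weight n : R := \sum_(x : K * n.+1.-tuple (S * A * B))
  path_weight Q alpha p i pi sg x.1 n (path_of x).

Let pw_ge0 k n f : 0 <= path_weight Q alpha p i pi sg k n f.
Proof. exact: (path_weight_ge0 Q_kernel alpha_gt0 delta_gt0 epsilon_gt0 regular). Qed.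

(** Both sides are the expected discount at jump [n.+1], split along paths with [n.+2] and with
    [n.+1] letters. *)
Let weightS n : weight n.+1 = \sum_(x : K * n.+1.-tuple (S * A * B))
    (\sum_j laplace Q alpha (path_of x n) j) *
      path_weight Q alpha p i pi sg x.1 n (path_of x).
Proof.
apply: EFin_inj.
rewrite -(discountedT Q_kernel alpha_gt0 delta_gt0 epsilon_gt0 regular law).
by rewrite -(discountedST Q_kernel alpha_gt0 delta_gt0 epsilon_gt0 regular law).
Qed.

Let weight_ge0 n : 0 <= weight n.
Proof. by rewrite sumr_ge0. Qed.

(** The expected discount starts at 1, as the 0-th jump time is 0, and each jump contracts it by at
    least the factor [beta]. *)
Let weight_le n : weight n <= beta ^+ n.
Proof.
elim: n => [|n IH].
  rewrite -lee_fin -(discountedT Q_kernel alpha_gt0 delta_gt0 epsilon_gt0 regular law).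
  by rewrite discounted0// probability_setT.
rewrite exprS; apply: le_trans (ler_wpM2l laplace_bound_ge0 IH).
by rewrite weightS mulr_sumr; apply: ler_sum => x _; rewrite ler_wpM2r.
Qed.

Let stage_le n : stage_value pi sg n <= payoff_bound * (weight n - weight n.+1).
Proof.
rewrite weightS -sumrB mulr_sumr; apply: ler_sum => x _ /=.
rewrite -mulrA [X in _ <= _ * X](_ : _ = exit_rate Q alpha (path_of x n) *
  path_weight Q alpha p i pi sg x.1 n (path_of x)); last by rewrite mulrBl mul1r.
rewrite ler_wpM2r ?payoff_bound_ge//.
by rewrite mulr_ge0 ?exit_rate_ge0.
Qed.

Let stage_ge0 n : 0 <= stage_value pi sg n.
Proof.
rewrite sumr_ge0// => x _ /=; rewrite mulr_ge0// mulr_ge0 ?exit_rate_ge0//.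
by rewrite mulr_ge0// invr_ge0 ltW.
Qed.

Lemma truncated_payoffE n :
  truncated_payoff c alpha n P = (truncated_value n pi sg)%:E.
Proof.
rewrite /truncated_payoff -sumEFin; apply: eq_bigr => m _.
exact: (expected_stage_payoff Q_kernel c_ge0 alpha_gt0 delta_gt0 epsilon_gt0
  regular law).
Qed.

Lemma payoffE : payoff c alpha P = (\sum_(0 <= m <oo) (stage_value pi sg m)%:E)%E.
Proof.
rewrite /payoff; under eq_integral do rewrite discounted_payoffE//.
rewrite integral_nneseries//.
- apply: eq_eseriesr => m _.
  rewrite -(expected_stage_payoff Q_kernel c_ge0 alpha_gt0 delta_gt0 epsilon_gt0
    regular law).
  by rewrite unlock.
- by move=> m; apply/measurable_EFinP; exact: measurable_stage_payoff.
- by move=> m w _; rewrite lee_fin; exact: stage_payoff_ge0.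
Qed.

Lemma truncated_value_le_payoff n :
  ((truncated_value n pi sg)%:E <= payoff c alpha P)%E.
Proof.
rewrite payoffE /truncated_value -sumEFin.
rewrite -(big_mkord xpredT (fun m => (stage_value pi sg m)%:E)).
by apply: nneseries_lim_ge => m _; rewrite lee_fin.
Qed.

(** By [stage_le] each stage payoff is paid for by the drop of [weight], so the sums telescope and
    the tail after stage [n] costs at most [payoff_bound * weight n.+1]. *)
Lemma payoff_le_truncated_value n :
  (payoff c alpha P <= (truncated_value n pi sg + payoff_bound * beta ^+ n.+1)%:E)%E.
Proof.
rewrite payoffE; apply: lime_le.
  by apply: is_cvg_nneseries => m _ _; rewrite lee_fin.
apply: nearW => N; rewrite sumEFin lee_fin.
pose s N := \sum_(0 <= m < N) stage_value pi sg m.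
pose u N := s N + payoff_bound * weight N.
have sS M : s M.+1 = s M + stage_value pi sg M by rewrite /s big_nat_recr.
have s_nd : nondecreasing_seq s.
  by apply/nondecreasing_seqP => M; rewrite sS lerDl.
have u_ni : nonincreasing_seq u.
  apply/nonincreasing_seqP => M; rewrite /u sS.
  by have := stage_le M; lra.
(* Passing through the larger of [N] and [n.+1] treats short and long partial sums alike. *)
apply: (@le_trans _ _ (u n.+1)).
  apply: le_trans (s_nd _ _ (leq_maxl N n.+1)) _.
  apply: le_trans (u_ni _ _ (leq_maxr N n.+1)).
  by rewrite lerDl mulr_ge0// payoff_bound_ge0.
rewrite /u /s big_mkord lerD2l ler_wpM2l ?payoff_bound_ge0//.
Qed.

End Play.

Definition dirac_dist (E : pfinType) : dist R E.
Proof.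
apply: (@Dist R E (fun e => (e == point)%:R)); first by move=> e; exact: ler0n.
by rewrite (bigD1 point)//= eqxx big1 ?addr0// => e /negbTE ->.
Defined.

(** A stage [m <= n] together with a type and a path through stage [m]: the monomials of the
    bilinear form. *)
Let Index n := {m : 'I_n.+1 & (K * m.+1.-tuple (S * A * B))%type}.

Let coef n (y : Index n) : R :=
  let l := path_of (tagged y) (tag y) in
  alpha^-1 * c (tagged y).1 l.1.1 l.1.2 l.2 * exit_rate Q alpha l *
  nature_weight Q alpha p i (tagged y).1 (tag y) (path_of (tagged y)).

Let reach1 n (y : Index n) (pi : policy1 R K S A B) :=
  reach (fun l => l.1.2) (fun n => @pi n (tagged y).1) (tag y).+1 (path_of (tagged y)).

Let reach2 n (y : Index n) (sg : policy2 R S A B) :=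
  reach (fun l => l.2) sg (tag y).+1 (path_of (tagged y)).

Lemma truncated_valueE n pi sg :
  truncated_value n pi sg = \sum_(y : Index n) coef y * reach1 y pi * reach2 y sg.
Proof.
rewrite /truncated_value /stage_value sig_big_dep/=.
by apply: eq_bigr => y _; rewrite /path_weight /coef !mulrA.
Qed.

(** Reach probabilities lie in [0, 1], which bounds the form and supplies the net, and Kuhn's
    theorem supplies the mixtures for both players. *)
Lemma truncated_value_approx n : exists v,
  approx_value (fun pi sg => (truncated_value n pi sg)%:E) v.
Proof.
have r1 (y : Index n) pi : 0 <= reach1 y pi <= 1 by exact: reach_itv.
have r2 (y : Index n) sg : 0 <= reach2 y sg <= 1 by exact: reach_itv.
apply: (@approx_minimax R _ _ (truncated_value n) (\sum_(y : Index n) `|coef y|)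
  (fun _ _ _ => dirac_dist A) (fun _ _ => dirac_dist B)).
- move=> pi sg; rewrite truncated_valueE (le_trans (ler_norm_sum _ _ _))//.
  apply: ler_sum => y _; rewrite !normrM -mulrA -[leRHS]mulr1 ler_wpM2l//.
  have /andP[? ?] := r1 y pi; have /andP[? ?] := r2 y sg.
  by rewrite mulr_ile1// ger0_norm.
- move=> e e0.
  have [J [f hf]] := bilinear_net (coef (n := n)) (fun _ _ _ => dirac_dist A) r1 r2 e0.
  exists J, f => pi; have [j hj] := hf pi; exists j => sg.
  by rewrite !truncated_valueE.
- move=> J f mu.
  (* Player 1 knows the type, so the mixture is realized separately for each type, with the same
     weights [mu]. *)
  have ex k := reach_mixture (fun l : S * A * B => l.1.2) (fun j n => @f j n k) mu.
  exists (fun n k => projT1 (cid (ex k)) n) => sg.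
  rewrite truncated_valueE.
  under [RHS]eq_bigr do rewrite truncated_valueE mulr_sumr.
  rewrite exchange_big/=; apply: eq_bigr => y _.
  rewrite /reach1 (projT2 (cid (ex (tagged y).1))) mulr_sumr mulr_suml.
  by apply: eq_bigr => j _; ring.
- move=> sg1 sg2 l /andP[l0 l1].
  (* A mixture of two strategies is one indexed by the booleans, with weight [l] on [sg2]. *)
  pose m (b : bool) := if b then l else 1 - l.
  have m0 b : 0 <= m b by case: b => //=; rewrite subr_ge0.
  have m1 : \sum_b m b = 1 by rewrite big_bool/= subrKC.
  have [sg hsg] := reach_mixture (fun l : S * A * B => l.2)
    (fun b : bool => if b then sg2 else sg1) (Dist m0 m1).
  exists sg => pi; rewrite !truncated_valueE !mulr_sumr -big_split/=.
  apply: eq_bigr => y _; rewrite /reach2 hsg big_bool/=; ring.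
Qed.

End Game.

Theorem theorem3p4 (R : realType) (K S A B : pfinType)
    (Q : R -> S -> S -> A -> B -> R) (c : K -> S -> A -> B -> R) (alpha : R)
    (Q_kernel : semi_markov_kernel Q)
    (c_ge0 : forall k i a b, 0 <= c k i a b)
    (alpha_gt0 : 0 < alpha)
    (P : dist R K -> S -> policy1 R K S A B -> policy2 R S A B ->
         probability (Omega R K S A B) R)
    (P_law : forall p i pi sigma, game_law Q p i pi sigma (P p i pi sigma))
    (delta epsilon : R)
    (delta_gt0 : 0 < delta) (epsilon_gt0 : 0 < epsilon)
    (epsilon_lt1 : epsilon < 1)
    (regular : forall i a b, sojourn_cdf Q delta i a b <= 1 - epsilon)
    (p : dist R K) :
  exists (Vstar : S -> R) (Vnstar : nat -> S -> R),
    [/\ forall i,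
          has_value (fun pi sigma => payoff c alpha (P p i pi sigma)) (Vstar i),
        forall n i,
          has_value (fun pi sigma => truncated_payoff c alpha n (P p i pi sigma))
            (Vnstar n i)
      & forall i, Vnstar n i @[n --> \oo] --> Vstar i].
Proof.
have exVn i n := truncated_value_approx Q c alpha p i n.
pose Vn n i := projT1 (cid (exVn i n)).
have Vn_value n i := projT2 (cid (exVn i n)).
have beta0 := laplace_bound_ge0 Q_kernel alpha_gt0 delta_gt0 epsilon_gt0 regular.
have beta1 := laplace_bound_lt1 alpha_gt0 delta_gt0 epsilon_gt0.
have err0 : (payoff_bound c alpha * laplace_bound alpha delta epsilon ^+ n.+1)
    @[n --> \oo] --> (0 : R).
  rewrite -[X in _ --> X](mulr0 (payoff_bound c alpha)); apply: cvgM.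
    exact: cvg_cst.
  have h : laplace_bound alpha delta epsilon ^+ n @[n --> \oo] --> (0 : R).
    by apply: cvg_expr; rewrite ger0_norm.
  by move: h; rewrite -cvg_shiftS.
(* The payoff lies between the truncated value and the truncated value plus a geometric error that
   is uniform in the policies. *)
have exV i := approx_value_limit (Vn_value^~ i)
  (fun n pi sg => truncated_value_le_payoff Q_kernel c_ge0 alpha_gt0 delta_gt0
     epsilon_gt0 regular (P_law p i pi sg) n)
  (fun n pi sg => payoff_le_truncated_value Q_kernel c_ge0 alpha_gt0 delta_gt0
     epsilon_gt0 regular (P_law p i pi sg) n) err0.
exists (fun i => projT1 (cid (exV i))), Vn; split => [i|n i|i].
- exact/approx_value_has_value/(projT2 (cid (exV i))).1.
- apply: approx_value_has_value.
  have -> : (fun pi sg => truncated_payoff c alpha n (P p i pi sg)) =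
      (fun pi sg => (truncated_value Q c alpha p i n pi sg)%:E).
    apply/funext => pi; apply/funext => sg.
    exact: (truncated_payoffE Q_kernel c_ge0 alpha_gt0 delta_gt0 epsilon_gt0
      regular (P_law p i pi sg)).
  exact: Vn_value.
- exact: (projT2 (cid (exV i))).2.
Qed.
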